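(* Let $d\ge2$. For $f,g\in C^1(\mathbb{S}^{d-1})$, $$\int_{\mathbb{S}^{d-1}}f(x)\,\nabla_0g(x)\,d\sigma(x)=-\int_{\mathbb{S}^{d-1}}\left(\nabla_0f(x)-(d-1)\,x\,f(x)\right)g(x)\,d\sigma(x)$$ (an identity of vectors in $\mathbb{R}^d$). Furthermore, for $f\in C^2(\mathbb{S}^{d-1})$ and $g\in C^1(\mathbb{S}^{d-1})$, $$\int_{\mathbb{S}^{d-1}}\nabla_0f\cdot\nabla_0g\,d\sigma=-\int_{\mathbb{S}^{d-1}}\Delta_0f(x)\,g(x)\,d\sigma(x).$$
   Context: $\mathbb{S}^{d-1}$ is the unit sphere in $\mathbb{R}^d$ and $d\sigma$ its surface area measure. For a function $f$ on $\mathbb{S}^{d-1}$ let $F(y)=f(y/\|y\|)$, $y\in\mathbb{R}^d\setminus\{0\}$. The spherical gradient is $\nabla_0f(x)=\nabla F(x)\in\mathbb{R}^d$ and the Laplace--Beltrami operator is $\Delta_0f(x)=\Delta F(x)$, for $x\in\mathbb{S}^{d-1}$, where $\nabla=(\partial_1,\ldots,\partial_d)$ and $\Delta=\sum_{i=1}^d\partial_i^2$. *)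

(* Defs.v *)
From HB Require Import structures.
From mathcomp Require Import all_boot all_order all_algebra.
From mathcomp Require Import all_classical all_reals all_analysis.
From mathcomp Require Import measurable_realfun.

Set Implicit Arguments.
Unset Strict Implicit.
Unset Printing Implicit Defensive.

Import Order.TTheory GRing.Theory Num.Theory.
Import numFieldNormedType.Exports.

Local Open Scope classical_set_scope.
Local Open Scope ring_scope.

(* 'rV_n carries the product sigma-algebra, generated by the coordinates, as the
   library does for n-tuples; over the reals this is the Borel sigma-algebra. *)
Section measurable_rV.
Context {d} {T : sigmaRingType d} (n : nat).

Let coord : 'I_n -> 'rV[T]_n -> T := fun i x => x 0 i.

Let rV_set0 : g_sigma_preimage coord set0.
Proof. exact: sigma_algebra0. Qed.

Let rV_setC A : g_sigma_preimage coord A -> g_sigma_preimage coord (~` A).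
Proof. exact: sigma_algebraC. Qed.

Let rV_bigcup (F : _^nat) : (forall i, g_sigma_preimage coord (F i)) ->
  g_sigma_preimage coord (\bigcup_i (F i)).
Proof. exact: sigma_algebra_bigcup. Qed.

HB.instance Definition _ := @isMeasurable.Build (measure_tuple_display d)
  'rV[T]_n (g_sigma_preimage coord) rV_set0 rV_setC rV_bigcup.

End measurable_rV.

Lemma measurable_rV_coord d (T : sigmaRingType d) n (i : 'I_n) :
  measurable_fun [set: 'rV[T]_n] (fun x : 'rV[T]_n => x 0 i).
Proof.
move=> _ Y mY; rewrite setTI; apply: sub_sigma_algebra => /=.
rewrite -bigcup_seq/=; exists i => /=; first by rewrite mem_index_enum.
by exists Y => //; rewrite setTI.
Qed.

Lemma measurable_fun_rVP d1 d2 (T1 : measurableType d1) (T2 : measurableType d2)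
    n (f : T1 -> 'rV[T2]_n) :
  (forall i, measurable_fun [set: T1] (fun x => f x 0 i)) ->
  measurable_fun [set: T1] f.
Proof.
move=> mf _ A mA; rewrite setTI.
have : <<s \big[setU/set0]_(i < n) preimage_set_system setT
    (fun x : 'rV[T2]_n => x 0 i) measurable >> A by [].
move: A {mA}; apply: smallest_sub => /=.
  split => /=.
  - by rewrite preimage_set0.
  - by move=> A mA; rewrite setTD -preimage_setC; exact: measurableC.
  - by move=> F mF; rewrite preimage_bigcup; exact: bigcupT_measurable.
move=> A; rewrite -bigcup_seq => -[i _ [B mB <-]] /=.
by have := mf i measurableT B mB; rewrite !setTI.
Qed.

Section lebesgue_rV.
Variable R : realType.

Definition cons_rV n (p : measurableTypeR R * 'rV[R]_n) : 'rV[R]_n.+1 :=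
  row_mx p.1%:M p.2.

Lemma measurable_cons_rV n : measurable_fun setT (@cons_rV n).
Proof.
apply: measurable_fun_rVP => i; rewrite /cons_rV.
have [j ->|j ->] := split_ordP (i : 'I_(1 + n)).
  rewrite [X in measurable_fun _ X](_ : _ = fst); first exact: measurable_fst.
  by apply/funext => p; rewrite (@row_mxEl _ 1 1 n) ord1 mxE eqxx mulr1n.
rewrite [X in measurable_fun _ X](_ : _ = (fun v : 'rV[R]_n => v 0 j) \o snd).
  exact: (measurableT_comp (@measurable_rV_coord _ R n j)).
by apply/funext => p; rewrite (@row_mxEr _ 1 1 n).
Qed.

HB.instance Definition _ n := isMeasurableFun.Build _ _ _ _ (@cons_rV n)
  (@measurable_cons_rV n).

Section lebesgue_rV_step.
Variables (n : nat) (mu : {sigma_finite_measure set 'rV[R]_n -> \bar R}).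

Definition lebesgue_rV_step : set 'rV[R]_n.+1 -> \bar R :=
  pushforward (lebesgue_measure \x mu)%E (@cons_rV n).

Let step0 : lebesgue_rV_step set0 = 0%E.
Proof. by rewrite /lebesgue_rV_step /pushforward preimage_set0 measure0. Qed.

Let step_ge0 A : (0 <= lebesgue_rV_step A)%E.
Proof. exact: measure_ge0. Qed.

Let step_sigma_additive : semi_sigma_additive lebesgue_rV_step.
Proof. exact: measure_semi_sigma_additive. Qed.

HB.instance Definition _ := isMeasure.Build _ _ _
  lebesgue_rV_step step0 step_ge0 step_sigma_additive.

Let sigma_finite_lebesgue_rV_step : sigma_finite setT lebesgue_rV_step.
Proof.
pose h (v : 'rV[R]_n.+1) : measurableTypeR R * 'rV[R]_n :=
  (v 0 (lshift n (0 : 'I_1)), \row_j v 0 (rshift 1 j)).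
have consK : cancel (@cons_rV n) h.
  move=> [x v]; rewrite /h /cons_rV /=; congr pair.
    by rewrite (@row_mxEl _ 1 1 n) mxE eqxx mulr1n.
  by apply/rowP => j; rewrite mxE (@row_mxEr _ 1 1 n).
have mh : measurable_fun setT h.
  apply/measurable_fun_pairP; split.
    exact: (@measurable_rV_coord _ R n.+1 (lshift n (0 : 'I_1))).
  apply: measurable_fun_rVP => j.
  rewrite [X in measurable_fun _ X](_ : _ =
    fun v : 'rV[R]_n.+1 => v 0 (rshift 1 j)).
    exact: (@measurable_rV_coord _ R n.+1 (rshift 1 j)).
  by apply/funext => v; rewrite /= mxE.
have [F FT mF] : sigma_finite setT (lebesgue_measure \x mu)%E.
  have /sigma_finiteP[F [TF ndF Foo]] := sigma_finiteT (@lebesgue_measure R).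
  have /sigma_finiteP[G [TG ndG Goo]] := sigma_finiteT mu.
  exists (fun n => F n `*` G n).
    rewrite -setXTT TF TG predeqE => -[x y]; split.
      move=> [/= [k _ Fkx] [l _ Gly]]; exists (maxn k l) => //; split.
      - by move: x Fkx; exact/subsetPset/ndF/leq_maxl.
      - by move: y Gly; exact/subsetPset/ndG/leq_maxr.
    by move=> [k _ []/= ? ?]; split; exists k.
  move=> k; have [? ?] := Foo k; have [? ?] := Goo k.
  split; first exact: measurableX.
  by rewrite product_measure1E// lte_mul_pinfty// ge0_fin_numE.
exists (fun i => h @^-1` F i) => [|i].
  by rewrite -preimage_bigcup -FT preimage_setT.
have [mFi Fioo] := mF i; split; first by
  rewrite -[X in measurable X]setTI; exact: mh.
rewrite /lebesgue_rV_step /pushforward -comp_preimage.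
by rewrite (_ : h \o _ = id) ?preimage_id//; apply/funext => p /=; exact: consK.
Qed.

HB.instance Definition _ := Measure_isSigmaFinite.Build _ _ _
  lebesgue_rV_step sigma_finite_lebesgue_rV_step.

End lebesgue_rV_step.

(* Lebesgue measure on R^n, as the n-fold product of Lebesgue measure on R. *)
Fixpoint lebesgue_rV n : {sigma_finite_measure set 'rV[R]_n -> \bar R} :=
  if n is n'.+1 then lebesgue_rV_step (lebesgue_rV n') else \d_(0 : 'rV[R]_0).

End lebesgue_rV.

Section sphere.
Variables (R : realType) (d : nat).
Implicit Types (x y : 'rV[R]_d) (f F : 'rV[R]_d -> R).

Definition dotv x y : R := \sum_i x 0 i * y 0 i.

(* The library's norm on 'rV[R]_d is the sup norm; this is the Euclidean one. *)
Definition enorm x : R := Num.sqrt (dotv x x).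

Definition sphere : set 'rV[R]_d := [set x | enorm x = 1].

Definition punctured : set 'rV[R]_d := [set~ 0].

Definition normalize y : 'rV[R]_d := (enorm y)^-1 *: y.

Lemma measurable_enorm : measurable_fun setT enorm.
Proof.
rewrite [X in measurable_fun _ X](_ : _ =
  fun x => if dotv x x == 0 then 0 else dotv x x `^ 2^-1).
  have md : measurable_fun setT (fun x => dotv x x).
    apply: (@measurable_sum _ 'rV[R]_d R setT _ _
      (fun i (x : 'rV[R]_d) => x 0 i * x 0 i)) => i.
    apply: measurable_funM; exact: measurable_rV_coord.
  apply: measurable_fun_if => //=; first exact: measurable_fun_eqr.
  apply: measurable_funTS.
  exact: (measurableT_comp (@measurable_powR R 2^-1) md).
apply/funext => x; rewrite /enorm.
case: eqP => [->|/eqP x0]; first by rewrite sqrtr0.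
by rewrite -powR12_sqrt// /dotv sumr_ge0// => i _; exact: sqr_ge0.
Qed.

Lemma measurable_normalize : measurable_fun setT normalize.
Proof.
apply: measurable_fun_rVP => i.
rewrite [X in measurable_fun _ X](_ : _ =
  fun x => enorm x `^ (-1) * x 0 i).
  apply: measurable_funM; last exact: measurable_rV_coord.
  exact: (measurableT_comp (@measurable_powR R (-1)) measurable_enorm).
apply/funext => x; rewrite /normalize mxE powR_inv1//.
exact: sqrtr_ge0.
Qed.

HB.instance Definition _ :=
  isMeasurableFun.Build _ _ _ _ normalize measurable_normalize.

Definition punctured_ball : set 'rV[R]_d := [set y | 0 < enorm y <= 1].

Lemma measurable_punctured_ball : measurable punctured_ball.
Proof.
rewrite (_ : punctured_ball = enorm @^-1` `]0, 1]%classic).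
  by rewrite -[X in measurable X]setTI; apply: measurable_enorm.
by apply/seteqP; split=> y /=; rewrite in_itv.
Qed.

Definition cone A : set 'rV[R]_d := normalize @^-1` A `&` punctured_ball.

(* Surface area measure: sigma(A) is d times the volume of the cone
   { r x | x in A, |x| = 1, 0 < r <= 1 } over A, so that
   dy = r^(d-1) dr dsigma in polar coordinates. *)
Definition surface_measure A : \bar R := (d%:R%:E * lebesgue_rV R d (cone A))%E.

Section surface_measure_is_measure.

Let cone_measure : {measure set 'rV[R]_d -> \bar R} :=
  measure_function_pushforward__canonical__measure_function_Measure
    (mrestr (lebesgue_rV R d) measurable_punctured_ball) measurable_normalize.

Let surface0 : surface_measure set0 = 0%E.
Proof. exact: (measure0 (mscale d%:R%:nng cone_measure)). Qed.

Let surface_ge0 A : (0 <= surface_measure A)%E.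
Proof. exact: (measure_ge0 (mscale d%:R%:nng cone_measure)). Qed.

Let surface_sigma_additive : semi_sigma_additive surface_measure.
Proof.
exact: (@measure_semi_sigma_additive _ _ _ (mscale d%:R%:nng cone_measure)).
Qed.

HB.instance Definition _ := isMeasure.Build _ _ _
  surface_measure surface0 surface_ge0 surface_sigma_additive.

End surface_measure_is_measure.

(* The extension F(y) = f(y/|y|); only the values of f on the sphere matter.
   Its value at 0, where normalize 0 = 0, is never used. *)
Definition extend0 f y : R := f (normalize y).

Definition grad F x : 'rV[R]_d := \row_i 'D_'e_i F x.

Definition laplacian F x : R := \sum_i 'D_'e_i ('D_'e_i F) x.

(* All partial derivatives of order at most k exist and are continuous at the
   points of U; to be used with U open. *)
Fixpoint Ck_on k (U : set 'rV[R]_d) F : Prop :=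
  {in U, continuous F} /\
  if k is k'.+1 then
    forall i : 'I_d, {in U, forall y, derivable F y 'e_i} /\
      Ck_on k' U ('D_'e_i F)
  else True.

(* A function on the sphere is C^k when its 0-homogeneous extension is C^k on
   the punctured space. *)
Definition Ck_sphere k f : Prop := Ck_on k punctured (extend0 f).

Definition sgrad f x : 'rV[R]_d := grad (extend0 f) x.

Definition slaplacian f x : R := laplacian (extend0 f) x.

Definition sphere_integral f : R := \int[surface_measure]_(x in sphere) f x.

Definition sphere_vintegral (V : 'rV[R]_d -> 'rV[R]_d) : 'rV[R]_d :=
  \row_i sphere_integral (fun x => V x 0 i).

End sphere.

(* Main.v *)
Require Import Defs.
From mathcomp Require Import all_boot all_order all_algebra.
From mathcomp Require Import all_classical all_reals all_analysis.
From mathcomp Require Import measurable_realfun ring lra.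

Set Implicit Arguments.
Unset Strict Implicit.
Unset Printing Implicit Defensive.

Import Order.TTheory GRing.Theory Num.Theory.
Import numFieldNormedType.Exports.

Local Open Scope classical_set_scope.
Local Open Scope ring_scope.

(** Both identities reduce to one fact: if H is C^1 on R^d \ {0} and homogeneous
    of degree 0, then the integral over the sphere of d_i H - (d-1) x_i H
    vanishes. The first identity is the case H = F G; the second one is obtained
    by taking H = r d_i F G with r = |y| and summing over i, the terms
    in sum_i x_i d_i F being zero by Euler's relation.

    For the key fact, let q = |y|^2 and consider the field
      V_j = (q delta_ij - y_i y_j) psi(q) H / r,
    where psi is a C^1 cutoff supported away from 0 and infinity. It is tangent
    to the spheres, so psi' drops out of its divergence, which is
      psi(q) (d_i H - (d-1) x_i H)(y/|y|).
    The integral over R^d of each d_j V_j is zero, because Lebesgue measure is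
    translation invariant and difference quotients converge dominatedly. Letting
    psi tend to the indicator of ]0, 1] leaves the integral over the unit ball
    that defines the surface measure. *)

(** * Borel sets of R^n and translation invariance *)

Section measurability.
Variables (R : realType) (d : nat).

Lemma ball_rVP (x y : 'rV[R]_d) (e : R) :
  ball x e y <-> 0 < e /\ forall j, `|x 0 j - y 0 j| < e.
Proof.
split=> [[e0 H]|[e0 H]]; split => //.
  by move=> j; have := H ord0 j; rewrite -ball_normE.
by move=> i j; rewrite ord1 -ball_normE; exact: H.
Qed.

Lemma measurable_ball_rV (x : 'rV[R]_d) (e : R) : measurable (ball x e).
Proof.
have [e0|e0] := ltP 0 e; last first.
  rewrite (_ : ball x e = set0)//; apply/seteqP; split=> // y /ball_rVP[].
  by rewrite ltNge e0.
rewrite (_ : ball x e =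
    \bigcap_(j in [set: 'I_d]) (fun y : 'rV[R]_d => y 0 j) @^-1` ball (x 0 j) e).
  apply: fin_bigcap_measurable => // j _; rewrite -[X in measurable X]setTI.
  by apply: measurable_rV_coord => //; apply: open_measurable; exact: ball_open.
apply/seteqP; split=> y /=.
  by move=> /ball_rVP[_ H] j _; rewrite -ball_normE; exact: H.
move=> H; apply/ball_rVP; split=> // j.
by have := H j I; rewrite /= -ball_normE.
Qed.

(** An open set is the countable union of the sup-norm balls with rational centre and radius 1/(k+1)
    that it contains, and each ball is a finite intersection of coordinate preimages. *)
Lemma open_measurable_rV (A : set 'rV[R]_d) : open A -> measurable A.
Proof.
move=> oA.
pose B (p : 'rV[rat]_d * nat) := ball (map_mx ratr p.1 : 'rV[R]_d) p.2.+1%:R^-1.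
rewrite (_ : A = \bigcup_p (if `[< B p `<=` A >] then B p else set0)); last first.
  apply/seteqP; split=> [y Ay|y [p _]]; last by case: asboolP => // + By; exact.
  have /nbhs_ballP[e /= e0 Be] := open_nbhs_nbhs (conj oA Ay).
  (* Half of e: a ball of this radius that contains y then lies in the ball of radius e around y. *)
  have [k _ ke] : exists2 k, True & k.+1%:R^-1 < e / 2.
    exists (Num.truncn (e / 2)^-1) => //.
    rewrite invf_plt ?posrE ?ltr0n ?divr_gt0//.
    by rewrite truncnS_gt// invr_ge0 divr_ge0// ltW.
  have k0 : 0 < k.+1%:R^-1 :> R by rewrite invr_gt0.
  have qP j : exists q : rat, `|ratr q - y 0 j| < k.+1%:R^-1.
    have [q] := @rat_in_itvoo R (y 0 j - k.+1%:R^-1) (y 0 j + k.+1%:R^-1)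
      ltac:(by rewrite ltrD2l gtrN).
    by rewrite in_itv/= => qq; exists q; rewrite distrC ltr_distlC.
  pose q := \row_j sval (cid (qP j)).
  have qy : B (q, k) y.
    apply/ball_rVP; split => //= j; rewrite !mxE; exact: svalP (cid (qP j)).
  exists (q, k) => //; rewrite asboolT// => z Bz; apply: Be.
  have := ball_triangle (ball_sym qy) Bz; apply: le_ball.
  by rewrite (le_trans (lerD (ltW ke) (ltW ke)))// -splitr.
apply: countable_bigcupT_measurable => [|p]; first exact: countableP.
case: asboolP => // _; exact: measurable_ball_rV.
Qed.

Lemma continuous_on_measurable_fun (U : set 'rV[R]_d) (f : 'rV[R]_d -> R) :
  open U -> {in U, continuous f} -> measurable_fun U f.
Proof.
move=> oU cf;
  apply: (measurability (@RGenOpens.G R)) => [|/= _ [_ [a [b ->]] <-]].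
  exact: RGenOpens.measurableE.
apply: open_measurable_rV; rewrite openE => x [Ux fx]; apply: filterI.
  by apply: open_nbhs_nbhs.
have : nbhs (f x) `]a, b[%classic by apply: open_nbhs_nbhs; split => //;
  exact: interval_open.
exact: (cf x (mem_set Ux)).
Qed.

Lemma continuous_measurable_fun_rV (f : 'rV[R]_d -> R) :
  continuous f -> measurable_fun setT f.
Proof.
by move=> cf; apply: continuous_on_measurable_fun => [|x _];
  [exact: openT|exact: cf].
Qed.

End measurability.

(** * Translation invariance of Lebesgue measure *)

Section translation.
Variable R : realType.
Local Notation mu := (@lebesgue_measure R).

Lemma measurable_addr (a : R) :
  measurable_fun setT (+%R^~ a : measurableTypeR R -> measurableTypeR R).
Proof. exact: measurable_funD. Qed.

(** Lebesgue measure is determined by its values on half-open intervals, and translating an interval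
    keeps its length. *)
Lemma lebesgue_measure_translation (a : R) (A : set R) : measurable A ->
  pushforward mu (+%R^~ a : _ -> measurableTypeR R) A = mu A.
Proof.
move=> mA.
pose m := measure_function_pushforward__canonical__measure_function_Measure
  mu (measurable_addr a).
apply/esym/(@lebesgue_measure_unique R m) => //= _ [[u v]] _ <-.
rewrite /m /pushforward (_ : _ @^-1` _ = `]u - a, v - a]%classic); last first.
  by apply/seteqP; split=> x /=; rewrite !in_itv/= ltrBlDr lerBrDr.
rewrite !lebesgue_measure_itv/= !lte_fin ltrD2r; case: ifPn => // _.
by rewrite -!EFinB; congr EFin; ring.
Qed.

Lemma measurable_addr_rV n (w : 'rV[R]_n) :
  measurable_fun setT (fun y : 'rV[R]_n => y + w).
Proof.
apply: measurable_fun_rVP => i; under eq_fun do rewrite mxE.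
by apply: measurable_funD => //; exact: measurable_rV_coord.
Qed.

(** Induction on the dimension by slicing: the induction hypothesis translates each section in its
    last n coordinates, and one-dimensional invariance shifts the first coordinate. *)
Lemma lebesgue_rV_translation n (w : 'rV[R]_n) (A : set 'rV[R]_n) :
  measurable A ->
  lebesgue_rV R n ((fun y => y + w) @^-1` A) = lebesgue_rV R n A.
Proof.
elim: n => [|n IH] in w A *.
  by move=> _; congr (lebesgue_rV _ _ _); apply/seteqP; split=> y /=;
    rewrite (_ : y + w = y)//; apply/rowP => -[].
move=> mA; rewrite /= /lebesgue_rV_step /pushforward /= /product_measure1.
pose a := w 0 (lshift n (0 : 'I_1)); pose v : 'rV[R]_n := \row_j w 0 (rshift 1 j).
have consD x u : cons_rV (x, u) + w = cons_rV (x + a, u + v).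
  apply/rowP => i; rewrite mxE /cons_rV.
  have [j ->|j ->] := split_ordP (i : 'I_(1 + n)).
    by rewrite !(@row_mxEl _ 1 1 n) !ord1 !mxE eqxx !mulr1n.
  by rewrite !(@row_mxEr _ 1 1 n) !mxE.
have mB : measurable (@cons_rV R n @^-1` A).
  by rewrite -[X in measurable X]setTI; exact: measurable_cons_rV.
(* The measure of the slice of [A] at a given first coordinate; its integral is the measure of
   [A]. *)
pose h := lebesgue_rV R n \o xsection (@cons_rV R n @^-1` A).
have mh : measurable_fun setT h by exact: measurable_fun_xsection.
transitivity (\int[mu]_x h (x + a)%R)%E.
  apply: eq_integral => x _; rewrite /h /=.
  rewrite -[RHS](IH v); last exact: measurable_xsection.
  congr (lebesgue_rV _ _ _); apply/seteqP.
  by split=> u; rewrite /xsection /= !inE /= ?inE /= consD.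
have := @ge0_integral_pushforward _ _ _ _ _ _ (measurable_addr a) mu setT h
  measurableT mh (fun x _ => measure_ge0 _ _).
rewrite preimage_setT => <-.
pose m := measure_function_pushforward__canonical__measure_function_Measure
  mu (measurable_addr a).
rewrite -[LHS]/(\int[m]_x h x)%E; apply: eq_measure_integral => B mB' _.
exact: lebesgue_measure_translation.
Qed.

(** Closed cubes serve as the compact sets of finite measure that carry the supports. *)
Definition box n (M : R) : set 'rV[R]_n := [set y | forall i, `|y 0 i| <= M].
Arguments box n M : clear implicits.

Lemma measurable_box n M : measurable (box n M).
Proof.
rewrite (_ : box n M = \bigcap_(j in [set: 'I_n])
    (fun y : 'rV[R]_n => y 0 j) @^-1` `[-M, M]%classic).
  apply: fin_bigcap_measurable => // j _; rewrite -[X in measurable X]setTI.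
  by apply: measurable_rV_coord => //; exact: measurable_itv.
apply/seteqP; split=> y /= H j; first by move=> _ /=; rewrite in_itv/= -ler_norml.
by have := H j I; rewrite /= in_itv/= -ler_norml.
Qed.

Lemma lebesgue_rV_box n (M : R) : (lebesgue_rV R n (box n M) < +oo)%E.
Proof.
elim: n => [|n IH]; first by rewrite /= diracE ltry.
rewrite [lebesgue_rV _ _]/= /= /lebesgue_rV_step /pushforward.
rewrite (_ : _ @^-1` _ = `[-M, M]%classic `*` box n M).
  rewrite product_measure1E//=; last exact: measurable_box.
  rewrite lte_mul_pinfty// ge0_fin_numE// lebesgue_measure_itv/=.
  by case: ifPn; rewrite ?ltry.
apply/seteqP; split=> -[x u] /=; rewrite in_itv/= -ler_norml => H.
  split=> [|i]; first by have := H (lshift n (0 : 'I_1));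
    rewrite /cons_rV (@row_mxEl _ 1 1 n) !mxE eqxx mulr1n.
  by have := H (rshift 1 i); rewrite /cons_rV (@row_mxEr _ 1 1 n).
case: H => Hx Hu i; rewrite /cons_rV.
have [j ->|j ->] := split_ordP (i : 'I_(1 + n)).
  by rewrite (@row_mxEl _ 1 1 n) !ord1 !mxE eqxx mulr1n.
by rewrite (@row_mxEr _ 1 1 n).
Qed.

End translation.
Arguments box {R} n M.

(** * The integral of a derivative *)

Section line.
Variables (R : realType) (V : normedModType R).
Implicit Types (U : V -> R) (y v : V).

(** The two difference quotients are the same function of h. This makes one-variable calculus
    available for directional derivatives. *)
Lemma is_derive_line U y v (t l : R) :
  is_derive (y + t *: v) v U l -> is_derive t 1 (fun s : R => U (y + s *: v)) l.
Proof.
have E : (fun h : R => h^-1 *: ((U \o shift (y + t *: v)) (h *: v) - U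
  (y + t *: v)))
   = (fun h : R => h^-1 *: (((fun s : R => U (y + s *: v)) \o shift t) (h *: 1)
                      - (fun s : R => U (y + s *: v)) t)).
  apply/funext => h /=; congr (_ *: (U _ - _)).
  by rewrite addrCA [h *: 1]mulr1 scalerDl.
by move=> [dU <-]; split; move: dU; rewrite /derivable /derive E.
Qed.

(** The one-variable mean value theorem on [0, h] or [h, 0]; the bound by absolute values covers
    both signs of h. *)
Lemma MVT_line U (dU : V -> R) y v (h : R) :
  (forall t : R, `|t| <= `|h| -> is_derive (y + t *: v) v U (dU (y + t *: v))) ->
  exists2 t, `|t| <= `|h| & U (y + h *: v) - U y = h * dU (y + t *: v).
Proof.
move=> HU.
pose f s := U (y + s *: v); pose df s := dU (y + s *: v).
have fd (t : R) : `|t| <= `|h| -> is_derive t 1 f (df t).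
  by move=> /HU; exact: is_derive_line.
have fc (a b : R) : (forall t : R, t \in `[a, b] -> `|t| <= `|h|) ->
    {within `[a, b], continuous f}.
  move=> H; apply: derivable_within_continuous => t tI; by case: (fd t (H t tI)).
have [h0|h0] := leP 0 h.
  have Hh : forall s : R, s \in `[0, h] -> `|s| <= `|h|.
    by move=> s; rewrite in_itv/= => /andP[t0 th]; rewrite !ger0_norm.
  have [t tI E] := MVT_segment h0 (fun x xI => fd x (Hh x
    (subset_itv_oo_cc xI))) (fc _ _ Hh).
  exists t; first exact: Hh.
  by move: E; rewrite /f scale0r addr0 subr0 mulrC.
have Hh : forall s : R, s \in `[h, 0] -> `|s| <= `|h|.
  by move=> s; rewrite in_itv/= => /andP[t0 th]; rewrite !ler0_norm ?lerN2 // ltW.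
have [t tI E] := MVT_segment (ltW h0)
   (fun x xI => fd x (Hh x (subset_itv_oo_cc xI))) (fc _ _ Hh).
exists t; first exact: Hh.
move: E; rewrite /f scale0r addr0 sub0r => E.
by rewrite -opprB E /df; ring.
Qed.

End line.
Section integral_derivative.
Variables (R : realType) (n : nat).
Local Notation leb := (lebesgue_rV R n).
Implicit Types (U f : 'rV[R]_n -> R) (y v w : 'rV[R]_n).

Lemma compact_box (M : R) : compact (box n M).
Proof.
have := @rV_compact R n (fun=> `[-M, M]%classic) (fun=> @segment_compact _ _ _).
congr (compact _); apply/seteqP; split=> y /= H i.
  by have := H i; rewrite in_itv/= -ler_norml.
by rewrite in_itv/= -ler_norml; exact: H.
Qed.

Lemma open_setC_box (M : R) : open (~` box n M).
Proof.
apply: closed_openC; apply: compact_closed; last exact: compact_box.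
exact: norm_hausdorff.
Qed.

Lemma compact_bounded_fun f (K : set 'rV[R]_n) :
  compact K -> {within K, continuous f} ->
  exists2 C, 0 <= C & forall y, K y -> `|f y| <= C.
Proof.
move=> cK cf; have [->|/set0P K0] := eqVneq K set0; first by exists 0.
have cnf : {within K, continuous (fun y => `|f y|)}.
  by move=> y; exact: (cvg_norm (cf y)).
have [c _ Hc] := compact_EVT_max K0 cK cnf.
by exists `|f c| => // y Ky; apply: Hc; rewrite inE.
Qed.

Lemma support_box_bounded f (M : R) :
  continuous f -> (forall y, ~ box n M y -> f y = 0) ->
  exists2 C, 0 <= C & forall y, `|f y| <= C.
Proof.
move=> cf f0;
  have [C C0 H] := compact_bounded_fun (@compact_box M) (continuous_subspaceT cf).
exists C => // y; have [|/f0->] := pselect (box n M y); first exact: H.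
by rewrite normr0.
Qed.

Lemma integrable_support_box f (M C : R) :
  measurable_fun setT f -> (forall y, `|f y| <= C) ->
  (forall y, ~ box n M y -> f y = 0) -> leb.-integrable setT (EFin \o f).
Proof.
move=> mf fC f0; rewrite (_ : f = f \_ (box n M)); last first.
  apply/funext => y; rewrite patchE; case: ifPn => //; rewrite notin_setE.
  exact: f0.
rewrite -restrict_EFin; have mB := @measurable_box R n M;
  apply/(integrable_mkcond _ mB).
apply: measurable_bounded_integrable; first exact: measurable_box.
- exact: lebesgue_rV_box.
- exact: measurable_funTS.
- by exists C; split; [exact: num_real|move=> x Cx y _; exact: le_trans (ltW Cx)].
Qed.

Lemma integral_translation f w :
  measurable_fun setT f -> leb.-integrable setT (EFin \o f) ->
  leb.-integrable setT (fun y => (f (y + w))%:E) /\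
  (\int[leb]_y (f (y + w))%:E = \int[leb]_y (f y)%:E)%E.
Proof.
move=> mf intf.
pose m := measure_function_pushforward__canonical__measure_function_Measure
  leb (measurable_addr_rV w).
have eqm A : measurable A -> m A = leb A by exact: lebesgue_rV_translation.
have intw : leb.-integrable setT (fun y => (f (y + w))%:E).
  apply/integrableP; split.
    by apply/measurable_EFinP; apply: (measurableT_comp mf);
      exact: measurable_addr_rV.
  have /integrableP[_] := intf.
  rewrite -(@eq_measure_integral _ _ _ setT leb m) => [|A mA _]; last exact: eqm.
  rewrite (@ge0_integral_pushforward _ _ _ _ _ _ (measurable_addr_rV w))//.
  by apply: measurableT_comp => //; exact/measurable_EFinP.
split=> //.
rewrite -[RHS](@eq_measure_integral _ _ _ setT leb m) => [|A mA _];
  last exact: eqm.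
rewrite (@integral_pushforward _ _ _ _ _ _ (measurable_addr_rV w))//.
exact/measurable_EFinP.
Qed.

(** The complement of the box is open, so [U] vanishes in a neighbourhood of each of its points. *)
Lemma derive_support_box U (dU : 'rV[R]_n -> R) v (M : R) :
  (forall y, is_derive y v U (dU y)) ->
  (forall y, ~ box n M y -> U y = 0) -> forall y, ~ box n M y -> dU y = 0.
Proof.
move=> HU U0 y yM.
have HN : \near y, U y = cst 0 y.
  near=> z; apply: U0; near: z.
  by apply: open_nbhs_nbhs; split => //; exact: open_setC_box.
by case: (near_eq_is_derive HN (HU y)) => _ <-; rewrite derive_cst.
Unshelve. all: by end_near. Qed.

(** Difference quotients of [U] have integral zero by translation invariance. They converge to [dU]
    and, by the mean value theorem, are bounded by a bound of [dU], so dominated convergence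
    applies. *)
Lemma integral_derivative_eq0 U (dU : 'rV[R]_n -> R) v (M : R) :
  box n 1 v -> continuous U -> continuous dU ->
  (forall y, is_derive y v U (dU y)) ->
  (forall y, ~ box n M y -> U y = 0) ->
  \int[leb]_y dU y = 0.
Proof.
move=> v1 cU cdU HU U0.
have dU0 := derive_support_box HU U0.
have [C C0 dUC] := support_box_bounded cdU dU0.
have [C' C'0 UC] := support_box_bounded cU U0.
have mU := continuous_measurable_fun_rV cU.
have mdU := continuous_measurable_fun_rV cdU.
have intU := integrable_support_box mU UC U0.
pose h k : R := k.+1%:R^-1.
have h0 k : 0 < h k by rewrite /h invr_gt0.
have h1 k : h k <= 1 by rewrite /h invf_le1 ?ler1n.
pose f k y := (h k)^-1 * (U (y + h k *: v) - U y).
have mUw w : measurable_fun setT (fun y => U (y + w)).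
  by apply: (measurableT_comp mU); exact: measurable_addr_rV.
have mf k : measurable_fun setT (f k).
  by apply: measurable_funM => //; apply: measurable_funB.
have ff k : (\int[leb]_y (f k y)%:E = 0)%E.
  have [iw Ew] := integral_translation (h k *: v) mU intU.
  rewrite /f; under eq_integral do rewrite EFinM EFinB.
  rewrite integralZl//; last exact: integrableB.
  by rewrite integralB//= Ew subee ?mule0// integrable_fin_num.
(* The steps [h k] are at most 1 and [v] lies in the unit box, so all quotients are supported in the
   box enlarged by 1. *)
have [] := @dominated_convergence _ _ _ leb setT measurableT
  (fun k y => (f k y)%:E) (fun y => (dU y)%:E)
  (fun y => (C * \1_(box n (M + 1)) y)%:E).
- by move=> k; exact/measurable_EFinP.
- exact/measurable_EFinP.
- apply: aeW => y _; apply/cvg_EFin; first by near=> k.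
  have h_dnbhs : h @ \oo --> 0^'.
    move=> P /= HP; have [N _ HN] := @cvg_harmonic R _ HP.
    by exists N => // k /HN; apply; rewrite gt_eqF.
  have [dUy <-] := HU y.
  rewrite (_ : fine \o _ = fun k => (h k)^-1 *: ((U \o shift y)
    (h k *: v) - U y)).
    exact: (cvg_comp _ _ h_dnbhs dUy).
  by apply/funext => k; rewrite /f /= [y + _]addrC.
- have mB := @measurable_box R n (M + 1).
  have : leb.-integrable setT (EFin \o (C \o* \1_(box n (M + 1)))).
    apply: (@integrable_support_box _ (M + 1) C).
    + by apply: measurable_funM => //; exact: measurable_indic.
    + move=> y; rewrite /= indicE; case: (_ \in _) => /=;
        by rewrite ?mulr0 ?mulr1 ?mul1r ?mul0r ?normr0// ger0_norm.
    + by move=> y yM; rewrite /= indicE memNset// mul0r.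
  by apply: eq_integrable => // y _ /=; rewrite mulrC.
- apply: aeW => y k _; rewrite lee_fin /f.
  have [yM|yM] := pselect (box n (M + 1) y); last first.
    rewrite [U y]U0 => [|H]; last first.
      by apply: yM => i; rewrite (le_trans (H i))// lerDl.
    rewrite U0 => [|H]; last first.
      apply: yM => i; have := H i; rewrite !mxE => H1.
      have H2 : `|h k * v 0 i| <= 1.
        by rewrite normrM gtr0_norm// mulr_ile1// ltW.
      rewrite -[y 0 i](addrK (h k * v 0 i)) (le_trans (ler_normB _ _))//.
      by rewrite lerD.
    by rewrite subrr mulr0 normr0 mulr_ge0.
  rewrite indicE mem_set// mulr1.
  have [t _ ->] := MVT_line (h := h k) (y := y) (v := v) (fun t _ => HU
    (y + t *: v)).
  by rewrite mulKf ?gt_eqF.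
move=> _ _; under eq_fun do rewrite ff.
move=> Hc; rewrite /Rintegral.
by rewrite -(cvg_unique _ (@cvg_cst _ _ _ _ _) Hc).
Unshelve. all: by end_near. Qed.

End integral_derivative.

(** * Directional derivatives from continuous partial derivatives *)

(** By the mean value theorem in direction w, the quotient is c times [dU] at a point that tends to
    x with h. The base point x + h p moves with h, as the passage from one coordinate to the next
    requires. *)
Lemma derive_increment_cvg (R : realType) (V : normedModType R)
    (U dU : V -> R) (x p w : V) (c : R) :
  (\near x, is_derive x w U (dU x)) -> {for x, continuous dU} ->
  h^-1 * (U (x + h *: (p + c *: w)) - U (x + h *: p)) @[h --> 0^'] --> c * dU x.
Proof.
move=> HU cdU; apply/cvgrPdist_le => /= e e0.
have e1 : 0 < e / (`|c| + 1) by rewrite divr_gt0// ltr_wpDl.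
have /nbhs_ballP[d /= d0 Hd] : \forall z \near x,
    is_derive z w U (dU z) /\ `|dU x - dU z| <= e / (`|c| + 1).
  by apply: filterI => //; move/cvgrPdist_le: cdU; apply.
(* [K] times |h| bounds the norm of h p + t w for |t| <= |h c|; the summand 1 makes [K] positive. *)
pose K := `|p| + `|c| * `|w| + 1.
have K0 : 0 < K by rewrite ltr_wpDl// addr_ge0// mulr_ge0.
near=> h.
have hn0 : h != 0 by near: h; exact: nbhs_dnbhs_neq.
have hd : `|h| < d / K.
  near: h; apply: dnbhs0_lt; exact: divr_gt0.
have inball t : `|t| <= `|h * c| -> ball x d (x + h *: p + t *: w).
  move=> th; rewrite -ball_normE /= -addrA opprD addNKr normrN.
  rewrite (le_lt_trans (ler_normD _ _))// !normrZ.
  move: hd; rewrite ltr_pdivlMr//; apply: le_lt_trans.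
  rewrite /K !mulrDr -addrA lerD2l mulrA -normrM.
  by rewrite -[leLHS]addr0 lerD// ?mulr1// ler_wpM2r.
have [t /inball/Hd [_ th] E] := @MVT_line R V U dU (x + h *: p) w (h * c)
  (fun t th => (Hd _ (inball t th)).1).
rewrite scalerDr scalerA addrA E -[h * c * _]mulrA mulKf// -mulrBr normrM.
rewrite (le_trans (ler_wpM2l _ th))// mulrCA -[leRHS]mulr1 ler_wpM2l ?(ltW e0)//.
by rewrite ler_pdivrMr ?ltr_wpDl// mul1r lerDl.
Unshelve. all: by end_near. Qed.

(** The increment from x to x + h v is telescoped by switching on one coordinate of v at a time;
    each piece converges by [derive_increment_cvg]. *)
Lemma is_derive_partial (R : realType) n (U : 'rV[R]_n -> R)
    (dU : 'I_n -> 'rV[R]_n -> R) (x v : 'rV[R]_n) :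
  (forall i, \near x, is_derive x (delta_mx 0 i) U (dU i x)) ->
  (forall i, {for x, continuous (dU i)}) ->
  is_derive x v U (\sum_i v 0 i * dU i x).
Proof.
move=> HU cdU.
(* [p k] keeps the first k coordinates of v. *)
pose p k : 'rV[R]_n := \row_i (if (i < k)%N then v 0 i else 0).
have pS k (kn : (k < n)%N) : p k.+1 = p k + v 0 (Ordinal kn) *: delta_mx 0
  (Ordinal kn).
  apply/rowP => i; rewrite !mxE eqxx /= ltnS leq_eqVlt -val_eqE /=.
  case: ltngtP => [_|_|ik] /=; rewrite ?mulr0 ?addr0// mulr1 add0r.
  by congr (v _ _); apply: val_inj.
have H k : (k <= n)%N ->
    h^-1 * (U (x + h *: p k) - U x) @[h --> 0^'] -->
    \sum_(i < n | (i < k)%N) v 0 i * dU i x.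
  elim: k => [_|k IH kn].
    rewrite big_pred0 //; under eq_fun => h.
      rewrite (_ : p 0 = 0) ?scaler0 ?addr0 ?subrr ?mulr0; first over.
      by apply/rowP => i; rewrite !mxE.
    exact: cvg_cst.
  have := @derive_increment_cvg _ _ _ _ _ (p k) _ (v 0 (Ordinal kn))
    (HU (Ordinal kn)) (cdU _).
  rewrite -pS => H1.
  have -> : \sum_(i < n | (i < k.+1)%N) v 0 i * dU i x =
      \sum_(i < n | (i < k)%N) v 0 i * dU i x +
      v 0 (Ordinal kn) * dU (Ordinal kn) x.
    rewrite (bigD1 (Ordinal kn))//= addrC; congr (_ + _); apply: eq_bigl => i.
    by rewrite ltnS leq_eqVlt -val_eqE /=; case: ltngtP.
  have Ef h : h^-1 * (U (x + h *: p k.+1) - U x) =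
      h^-1 * (U (x + h *: p k) - U x) +
      h^-1 * (U (x + h *: p k.+1) - U (x + h *: p k)).
    by rewrite -mulrDr [X in _ = _ * X]addrC addrA subrK.
  by rewrite (eq_cvg _ _ Ef); exact: (cvgD (IH (ltnW kn)) H1).
have pn : p n = v by apply/rowP => i; rewrite mxE ltn_ord.
have := H n (leqnn n); rewrite pn (eq_bigl xpredT) => [Hv|i]; last exact: ltn_ord.
have Hv' : (fun h : R => h^-1 *: ((U \o shift x) (h *: v) - U x)) @ 0^' -->
    (\sum_i v 0 i * dU i x).
  by under eq_cvg => h do rewrite /= [_ + x]addrC.
by split; [apply/cvg_ex; eexists; exact: Hv'|exact: cvg_lim Hv'].
Qed.

(** * The Euclidean norm and the surface measure *)

Lemma continuous_at_sum (R : realType) (T : topologicalType) (I : Type)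
    (s : seq I) (F : I -> T -> R) (x : T) :
  (forall i, {for x, continuous (F i)}) ->
  {for x, continuous (fun y => \sum_(i <- s) F i y)}.
Proof.
by move=> cF; apply: cvg_big => [|i _]; [exact: add_continuous|exact: cF].
Qed.

Section euclidean.
Variables (R : realType) (d : nat).
Implicit Types (x y : 'rV[R]_d) (k : 'rV[R]_d -> R).

Lemma dotvv_ge0 y : 0 <= dotv y y.
Proof. by apply: sumr_ge0 => i _; exact: sqr_ge0. Qed.

Lemma sqr_coord_le_dotvv y i : y 0 i ^+ 2 <= dotv y y.
Proof. by rewrite /dotv (bigD1 i)//= expr2 lerDl sumr_ge0// => j _;
  exact: sqr_ge0. Qed.

Lemma dotvv_eq0 y : (dotv y y == 0) = (y == 0).
Proof.
apply/eqP/eqP => [y0|->]; last by rewrite /dotv big1// => i _; rewrite mxE mulr0.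
apply/rowP => i; rewrite mxE; apply/eqP; rewrite -sqrf_eq0 eq_le sqr_ge0 andbT.
by rewrite -y0 sqr_coord_le_dotvv.
Qed.

Lemma dotv00 : dotv (0 : 'rV[R]_d) 0 = 0.
Proof. by apply/eqP; rewrite dotvv_eq0. Qed.

Lemma dotvv_gt0 y : y != 0 -> 0 < dotv y y.
Proof. by move=> y0; rewrite lt0r dotvv_eq0 y0 dotvv_ge0. Qed.

Lemma enorm_gt0 y : y != 0 -> 0 < enorm y.
Proof. by move=> y0; rewrite sqrtr_gt0 dotvv_gt0. Qed.

Lemma enormZ (c : R) y : 0 <= c -> enorm (c *: y) = c * enorm y.
Proof.
move=> c0; rewrite /enorm (_ : dotv _ _ = c ^+ 2 * dotv y y).
  by rewrite sqrtrM ?sqr_ge0// sqrtr_sqr ger0_norm.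
by rewrite /dotv mulr_sumr; apply: eq_bigr => i _; rewrite !mxE; ring.
Qed.

Lemma normalizeZ (c : R) y : 0 < c -> normalize (c *: y) = normalize y.
Proof.
move=> c0; rewrite /normalize enormZ ?(ltW c0)// scalerA invfM mulrAC mulVf ?mul1r//.
by rewrite gt_eqF.
Qed.

Lemma enorm_normalize y : y != 0 -> enorm (normalize y) = 1.
Proof.
move=> y0; rewrite /normalize enormZ ?mulVf ?gt_eqF ?enorm_gt0//.
by rewrite invr_ge0 ltW ?enorm_gt0.
Qed.

Lemma normalize_sphere x : sphere x -> normalize x = x.
Proof. by move=> x1; rewrite /normalize x1 invr1 scale1r. Qed.

Lemma sphere_neq0 x : sphere x -> x != 0.
Proof.
move=> x1; apply/eqP => x0; have := oner_neq0 R.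
by rewrite -x1 x0 /enorm dotv00 sqrtr0 eqxx.
Qed.

Lemma continuous_dotvv : continuous (fun y => dotv y y).
Proof.
move=> y; rewrite /dotv; apply: continuous_at_sum => i.
by have c := @coord_continuous R 1 d 0 i y; exact: (cvgM c c).
Qed.

Lemma continuous_enorm : continuous (@enorm R d).
Proof.
move=> y; apply: (@continuous_comp _ _ _ (fun y => dotv y y) Num.sqrt).
  exact: continuous_dotvv.
exact: sqrt_continuous.
Qed.

Lemma open_punctured : open (@punctured R d).
Proof. by apply: closed_openC; apply: accessible_closed_set1;
  apply: hausdorff_accessible; exact: norm_hausdorff. Qed.

Lemma in_punctured y : y \in @punctured R d = (y != 0).
Proof. by apply/idP/idP => [|/eqP y0]; rewrite inE// => /eqP. Qed.

Lemma box_le_dotvv y (b : R) : 0 <= b -> dotv y y <= b ^+ 2 -> box d b y.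
Proof.
move=> b0 yb i; have := le_trans (sqr_coord_le_dotvv y i) yb.
by rewrite -[y 0 i ^+ 2]real_normK ?num_real // ler_pXn2r ?nnegrE.
Qed.

Lemma punctured_ballP y : punctured_ball y <-> y != 0 /\ dotv y y <= 1.
Proof.
rewrite /punctured_ball /=; split=> [/andP[y0 y1]|[y0 y1]].
  split; last by rewrite -(sqr_sqrtr (dotvv_ge0 y)) expr_le1 ?sqrtr_ge0.
  by apply: contraTneq y0 => ->; rewrite -leNgt /enorm dotv00 sqrtr0.
by rewrite enorm_gt0// -sqrtr1 ler_wsqrtr.
Qed.

Lemma punctured_ball_box y : punctured_ball y -> box d 1 y.
Proof. by move=> /punctured_ballP[_ y1]; apply: box_le_dotvv;
  rewrite ?expr1n. Qed.

Lemma compact_sphere : compact (@sphere R d).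
Proof.
apply: (subclosed_compact _ (@compact_box R d 1)).
  rewrite (_ : @sphere R d = @enorm R d @^-1` [set 1])//;
    apply: preimage_closed => //.
  by move=> y _; exact: continuous_enorm.
move=> y y1; apply: punctured_ball_box; rewrite /punctured_ball /= y1.
by rewrite ltr01 lexx.
Qed.

Lemma measurable_sphere : measurable (@sphere R d).
Proof.
rewrite (_ : @sphere R d = @enorm R d @^-1` [set 1])//.
by rewrite -[X in measurable X]setTI; exact: measurable_enorm.
Qed.

Lemma lebesgue_punctured_ball : (lebesgue_rV R d (@punctured_ball R d) < +oo)%E.
Proof.
apply: le_lt_trans (@lebesgue_rV_box R d 1); apply: le_measure.
- by rewrite inE; exact: measurable_punctured_ball.
- by rewrite inE; exact: measurable_box.
- by move=> y; exact: punctured_ball_box.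
Qed.

End euclidean.

(** The space splits into D, where the two measures agree, and its complement, where the restricted
    measure is zero. *)
Lemma ge0_integral_mrestr (dT : measure_display) (T : measurableType dT)
    (R : realType) (mu : {measure set T -> \bar R}) (D : set T)
    (mD : measurable D) (f : T -> \bar R) :
  measurable_fun setT f -> (forall x, 0 <= f x)%E ->
  (\int[mrestr mu mD]_x f x = \int[mu]_(x in D) f x)%E.
Proof.
move=> mf f0; have mDC := measurableC mD.
have -> : (\int[mrestr mu mD]_x f x = \int[mrestr mu mD]_(x in ~` D `|` D) f x)%E.
  by rewrite setvU.
rewrite ge0_integral_setU ?setvU//; last by rewrite disj_set2E setICl.
rewrite [X in (X + _)%E](@eq_measure_integral _ _ _ _ mzero); last first.
  by move=> A _ AD; rewrite /= /mrestr (_ : A `&` D = set0) ?measure0//;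
    apply/seteqP; split=> // x [/AD].
rewrite integral_measure_zero add0e.
by apply: eq_measure_integral => A _ AD; rewrite /= /mrestr setIidl.
Qed.

(** * Integrals against the surface measure *)

Section surface.
Variables (R : realType) (d : nat).
Local Notation leb := (lebesgue_rV R d).
Local Notation sigma := (@surface_measure R d).
Implicit Types k : 'rV[R]_d -> R.

(** [surface_measure] is d times the image under [normalize] of Lebesgue measure restricted to the
    punctured ball, so this is a change of variables. *)
Lemma ge0_integral_surface (f : 'rV[R]_d -> \bar R) :
  measurable_fun setT f -> (forall x, 0 <= f x)%E ->
  (\int[sigma]_x f x =
   d%:R%:E * \int[leb]_(y in @punctured_ball R d) f (normalize y))%E.
Proof.
move=> mf f0.
pose m1 : {measure set 'rV[R]_d -> \bar R} :=
  measure_function_pushforward__canonical__measure_function_Measure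
    (mrestr leb (@measurable_punctured_ball R d)) (@measurable_normalize R d).
transitivity (\int[mscale (d%:R%:nng)%R m1]_x f x)%E.
  by apply: eq_measure_integral.
rewrite ge0_integral_mscale//; congr (_ * _)%E.
rewrite (ge0_integral_pushforward (@measurable_normalize R d))//.
rewrite preimage_setT ge0_integral_mrestr//.
  by apply: measurableT_comp => //; exact: measurable_normalize.
by move=> x; exact: f0.
Qed.

Lemma surface_measure_sphere : (sigma (@sphere R d) < +oo)%E.
Proof.
rewrite /surface_measure lte_mul_pinfty//;
  apply: le_lt_trans (@lebesgue_punctured_ball R d).
apply: le_measure; rewrite ?inE;
  [|exact: measurable_punctured_ball|by move=> ? []].
apply: measurableI; last exact: measurable_punctured_ball.
by rewrite -[X in measurable X]setTI; apply: measurable_normalize => //;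
  exact: measurable_sphere.
Qed.

Lemma measurable_sphere_fun k :
  {in @punctured R d, continuous k} -> measurable_fun (@sphere R d) k.
Proof.
move=> ck; apply: (measurable_funS _ _ (continuous_on_measurable_fun
  (@open_punctured R d) ck)).
  by apply: open_measurable_rV; exact: open_punctured.
by move=> x /sphere_neq0/eqP.
Qed.

Lemma sphere_fun_bounded k : {in @punctured R d, continuous k} ->
  exists2 C, 0 <= C & forall x, @sphere R d x -> `|k x| <= C.
Proof.
move=> ck; apply: compact_bounded_fun; first exact: compact_sphere.
apply/continuous_in_subspaceT => x; rewrite inE => /sphere_neq0 x0.
by apply: ck; rewrite in_punctured.
Qed.

Lemma sphere_integrable k : {in @punctured R d, continuous k} ->
  sigma.-integrable (@sphere R d) (EFin \o k).
Proof.
move=> ck; apply: measurable_bounded_integrable.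
- exact: measurable_sphere.
- exact: surface_measure_sphere.
- exact: measurable_sphere_fun.
- have [C C0 HC] := sphere_fun_bounded ck.
  by exists C; split; [exact: num_real|move=> x Cx y /HC yC;
    exact: le_trans (ltW Cx)].
Qed.

Lemma sphere_integralE k : {in @punctured R d, continuous k} ->
  sphere_integral k =
  d%:R * \int[leb]_(y in @punctured_ball R d) k (normalize y).
Proof.
move=> ck; rewrite /sphere_integral Rintegral_mkcond.
(* Cutting [k] off outside the sphere makes it measurable and bounded on the whole space, and
   [normalize] sends the punctured ball into the sphere. *)
pose k0 := k \_ (@sphere R d); rewrite -/k0.
have mk0 : measurable_fun setT k0.
  by apply/(measurable_restrictT _ (@measurable_sphere R d));
    exact: measurable_sphere_fun.
have [C C0 HC] := sphere_fun_bounded ck.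
have k0C x : `|k0 x| <= C.
  by rewrite /k0 patchE; case: ifPn => [|_]; rewrite ?normr0// inE; exact: HC.
rewrite (_ : \int[leb]_(y in _) _ = \int[leb]_(y in @punctured_ball R d) k0
  (normalize y)); last first.
  apply: eq_Rintegral => y; rewrite inE => /punctured_ballP[y0 _].
  by rewrite /k0 patchE mem_set//; exact: enorm_normalize.
have ink0 : leb.-integrable (@punctured_ball R d) (fun y => (k0
  (normalize y))%:E).
  apply: measurable_bounded_integrable.
  - exact: measurable_punctured_ball.
  - exact: lebesgue_punctured_ball.
  - apply: measurable_funTS; apply: measurableT_comp => //;
    exact: measurable_normalize.
  - by exists C; split; [exact: num_real|move=> x Cx y _;
    exact: le_trans (ltW Cx)].
(* The change of variables is known for nonnegative functions, hence the split into positive and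
   negative parts, whose integrals are finite. *)
rewrite /Rintegral integralE [in RHS]integralE.
have mEk0 : measurable_fun setT (EFin \o k0) by exact/measurable_EFinP.
rewrite (ge0_integral_surface (measurable_funepos mEk0))//.
rewrite (ge0_integral_surface (measurable_funeneg mEk0))//.
have mB := @measurable_punctured_ball R d.
have := integrable_neg_fin_num mB ink0; have := integrable_pos_fin_num mB ink0.
rewrite (funepos_comp (EFin \o k0) (@normalize R d)).
rewrite (funeneg_comp (EFin \o k0) (@normalize R d)).
move=> fa fb; rewrite -muleBr ?fineM//.
  by rewrite fin_numD fin_numN; apply/andP.
by rewrite fin_num_adde_defr.
Qed.

End surface.

(** * The tangential field *)

Section directional.
Variables (R : realType) (V : normedModType R).

(** Converse of [is_derive_line] at parameter 0; together they transfer one-variable rules to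
    directional derivatives. *)
Lemma is_derive_of_line (U : V -> R) (y v : V) (l : R) :
  is_derive (0 : R) 1 (fun s => U (y + s *: v)) l -> is_derive y v U l.
Proof.
have E : (fun h : R => h^-1 *: ((U \o shift y) (h *: v) - U y))
   = (fun h : R => h^-1 *: (((fun s : R => U (y + s *: v)) \o shift 0) (h *: 1)
                      - (fun s : R => U (y + s *: v)) 0)).
  apply/funext => h /=; rewrite scale0r !addr0 [h *: 1]mulr1.
  by rewrite [y + _]addrC.
by move=> [dU <-]; split; move: dU; rewrite /derivable /derive E.
Qed.

Lemma is_derive_comp_real (g : R -> R) (f : V -> R) (y v : V) (l m : R) :
  is_derive (f y) 1 g l -> is_derive y v f m -> is_derive y v (g \o f) (l * m).
Proof.
move=> dg df; apply: is_derive_of_line.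
apply: (@is_derive1_comp R g (fun s => f (y + s *: v))).
  by rewrite scale0r addr0.
by apply: is_derive_line; rewrite scale0r addr0.
Qed.

End directional.

Section coordinates.
Variables (R : realType) (d : nat).
Implicit Types (y v : 'rV[R]_d).

Lemma is_derive_coord y v i : is_derive y v (fun z : 'rV[R]_d => z 0 i) (v 0 i).
Proof.
apply: is_derive_of_line.
rewrite (_ : (fun s : R => _) = (fun s => y 0 i + s * v 0 i)); last first.
  by apply/funext => s; rewrite !mxE.
by apply: is_derive_eq; rewrite /GRing.scale /=; ring.
Qed.

Lemma is_derive_dotvv y v :
  is_derive y v (fun z : 'rV[R]_d => dotv z z) (2 * dotv y v).
Proof.
have H i := is_deriveM (is_derive_coord y v i) (is_derive_coord y v i).
have E : \sum_(i < d) ((fun z : 'rV[R]_d => z 0 i) * (fun z => z 0 i)) =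
    (fun z : 'rV[R]_d => dotv z z).
  by apply/funext => z; rewrite fct_sumE.
rewrite -E; apply: (is_derive_eq (is_derive_sum H)).
by rewrite /dotv mulr_sumr; apply: eq_bigr => i _; rewrite /GRing.scale /=; ring.
Qed.

Lemma dotv_delta y j : dotv y (delta_mx 0 j) = y 0 j.
Proof.
rewrite /dotv (bigD1 j)//= big1 ?addr0; first by rewrite mxE !eqxx mulr1.
by move=> i ij; rewrite mxE eqxx (negbTE ij) mulr0.
Qed.

Lemma continuous_coord i : continuous (fun z : 'rV[R]_d => z 0 i).
Proof. exact: coord_continuous. Qed.

Lemma near_dotvv_lt (a : R) : 0 < a ->
  \forall y \near (0 : 'rV[R]_d), dotv y y < a.
Proof.
move=> a0; have := @continuous_dotvv R d 0.
by move=> /cvgr_lt; apply; rewrite dotv00.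
Qed.

(** Near the origin f is identically zero, so its continuity there is free. This handles fields
    built from functions that are regular only away from 0. *)
Lemma continuous_vanishing (f : 'rV[R]_d -> R) (a : R) : 0 < a ->
  (forall y, dotv y y < a -> f y = 0) ->
  (forall y, y != 0 -> {for y, continuous f}) -> continuous f.
Proof.
move=> a0 f0 cf y; have [->|/cf//] := eqVneq y 0.
have f00 : f 0 = 0 by apply: f0; rewrite dotv00.
have : f @ nbhs (0 : 'rV[R]_d) --> f 0; last exact.
apply/cvgrPdist_le => e e0; rewrite f00; near=> z.
rewrite f0 ?subrr ?normr0 ?ltW//; near: z; exact: near_dotvv_lt.
Unshelve. all: by end_near. Qed.

Lemma is_derive_vanishing (f df : 'rV[R]_d -> R) v (a : R) : 0 < a ->
  (forall y, dotv y y < a -> f y = 0) -> df 0 = 0 ->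
  (forall y, y != 0 -> is_derive y v f (df y)) ->
  forall y, is_derive y v f (df y).
Proof.
move=> a0 f0 df0 Hf y; have [->|/Hf//] := eqVneq y 0.
rewrite df0; apply: (@near_eq_is_derive _ _ _ (cst 0)).
by near=> z; rewrite f0//; near: z; exact: near_dotvv_lt.
Unshelve. all: by end_near. Qed.

End coordinates.

Section tangential_field.
Variables (R : realType) (d : nat).
Local Notation leb := (lebesgue_rV R d).
Implicit Types (y : 'rV[R]_d) (j : 'I_d) (x : R).
(** [eta] stands for psi(q)/r as a function of q = |y|^2. Hence its upper cutoff is at [b ^+ 2], so
    that the field is supported in the ball of radius b. *)
Variables (eta eta' : R -> R) (a b : R).
Hypotheses (a0 : 0 < a) (b0 : 0 <= b).
Hypothesis eta_derive : forall x : R, 0 < x -> is_derive x 1 eta (eta' x).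
Hypothesis eta'_cont : forall x : R, 0 < x -> {for x, continuous eta'}.
Hypothesis eta_small : forall x : R, x < a -> eta x = 0.
Hypothesis eta'_small : forall x : R, x < a -> eta' x = 0.
Hypothesis eta_large : forall x : R, b ^+ 2 < x -> eta x = 0.
Variables (H : 'rV[R]_d -> R) (dH : 'I_d -> 'rV[R]_d -> R).
Hypothesis H_cont : forall y, y != 0 -> {for y, continuous H}.
Hypothesis dH_cont : forall j y, y != 0 -> {for y, continuous (dH j)}.
Hypothesis H_derive : forall j y, y != 0 -> is_derive y (delta_mx 0 j) H (dH j y).
Hypothesis H_radial : forall y, y != 0 -> \sum_j y 0 j * dH j y = 0.
Variable i : 'I_d.

Let q (y : 'rV[R]_d) := dotv y y.
Let delta (j : 'I_d) : R := (i == j)%:R.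
(** Entry (i, j) of |y|^2 times the orthogonal projection onto the hyperplane orthogonal to y. *)
Let P j (y : 'rV[R]_d) : R := q y * delta j - y 0 i * y 0 j.
Let dP j (y : 'rV[R]_d) : R := 2 * y 0 j * delta j - (delta j * y 0 j + y 0 i).
Let A (y : 'rV[R]_d) : R := eta (q y) * H y.
Let dA j (y : 'rV[R]_d) : R :=
  eta' (q y) * (2 * y 0 j) * H y + eta (q y) * dH j y.
Let field j (y : 'rV[R]_d) := P j y * A y.
Let dfield j (y : 'rV[R]_d) := dP j y * A y + P j y * dA j y.

Let eta_cont (x : R) : 0 < x -> {for x, continuous eta}.
Proof. by move=> /eta_derive[dx _]; apply: differentiable_continuous;
  apply/derivable1_diffP. Qed.

Let P_derive j y : is_derive y (delta_mx 0 j) (P j) (dP j y).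
Proof.
have H1 := is_derive_coord y (delta_mx 0 j : 'rV[R]_d) i.
have H2 := is_derive_coord y (delta_mx 0 j : 'rV[R]_d) j.
have H3 := is_derive_dotvv y (delta_mx 0 j : 'rV[R]_d).
have H4 := is_deriveB (is_deriveM H3 (is_derive_cst (delta j : R) y
  (delta_mx 0 j : 'rV[R]_d))) (is_deriveM H1 H2).
apply: (is_derive_eq H4).
rewrite /dP dotv_delta !mxE !eqxx /= /GRing.scale /= /delta. ring.
Qed.

Let A_derive j y : y != 0 -> is_derive y (delta_mx 0 j) A (dA j y).
Proof.
move=> y0.
have H1 := @is_derive_comp_real R _ eta q y _ _ _ (eta_derive (dotvv_gt0 y0))
  (is_derive_dotvv y (delta_mx 0 j : 'rV[R]_d)).
have H2 := is_deriveM H1 (H_derive j y0).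
apply: (is_derive_eq H2); rewrite dotv_delta /dA /GRing.scale /= /q; ring.
Qed.

Let q_cont y : {for y, continuous q}. Proof. exact: continuous_dotvv. Qed.

Let P_cont j y : {for y, continuous (P j)}.
Proof.
have c1 := @continuous_coord R d i y; have c2 := @continuous_coord R d j y.
exact: (cvgB (cvgM (@q_cont y) (@cvg_cst _ (delta j) _ _ _)) (cvgM c1 c2)).
Qed.

Let dP_cont j y : {for y, continuous (dP j)}.
Proof.
have c1 := @continuous_coord R d i y; have c2 := @continuous_coord R d j y.
have c0 : {for y, continuous (fun=> delta j)} by exact: cst_continuous.
have c3 : {for y, continuous (fun=> 2 : R)} by exact: cst_continuous.
exact: (cvgB (cvgM (cvgM c3 c2) c0) (cvgD (cvgM c0 c2) c1)).
Qed.

Let etaq_cont y : y != 0 -> {for y, continuous (eta \o q)}.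
Proof. by move=> y0; apply: continuous_comp; [exact: q_cont|apply: eta_cont;
  exact: dotvv_gt0]. Qed.

Let A_cont y : y != 0 -> {for y, continuous A}.
Proof. by move=> y0; exact: (cvgM (etaq_cont y0) (H_cont y0)). Qed.

Let dA_cont j y : y != 0 -> {for y, continuous (dA j)}.
Proof.
move=> y0; have c2 := @continuous_coord R d j y.
have ce : {for y, continuous (eta' \o q)}.
  by apply: continuous_comp; [exact: q_cont|apply: eta'_cont; exact: dotvv_gt0].
have c3 : {for y, continuous (fun=> 2 : R)} by exact: cst_continuous.
have c4 : {for y, continuous (fun z => eta' (q z) * (2 * z 0 j))}.
  exact: (cvgM ce (cvgM c3 c2)).
have c5 : {for y, continuous (fun z => eta (q z) * dH j z)}.
  exact: (cvgM (etaq_cont y0) (@dH_cont j y y0)).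
exact: (cvgD (cvgM c4 (H_cont y0)) c5).
Qed.

Let A_small y : q y < a -> A y = 0.
Proof. by move=> ya; rewrite /A eta_small// mul0r. Qed.

Let dA_small j y : q y < a -> dA j y = 0.
Proof. by move=> ya; rewrite /dA eta_small// eta'_small// !mul0r addr0. Qed.

Let field_cont j : continuous (field j).
Proof.
apply: (continuous_vanishing a0) => y; first by move=> /A_small;
  rewrite /field => ->; rewrite mulr0.
by move=> y0; exact: (cvgM (@P_cont j y) (A_cont y0)).
Qed.

Let dfield_small j y : q y < a -> dfield j y = 0.
Proof. by move=> ya; rewrite /dfield A_small// dA_small// !mulr0 addr0. Qed.

Let dfield_cont j : continuous (dfield j).
Proof.
apply: (continuous_vanishing a0) => y; first exact: dfield_small.
move=> y0.
have c1 : {for y, continuous (fun z => dP j z * A z)}.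
  exact: (cvgM (@dP_cont j y) (A_cont y0)).
have c2 : {for y, continuous (fun z => P j z * dA j z)}.
  exact: (cvgM (@P_cont j y) (@dA_cont j y y0)).
exact: (cvgD c1 c2).
Qed.

Let field_derive j y : is_derive y (delta_mx 0 j) (field j) (dfield j y).
Proof.
move: y; apply: (is_derive_vanishing a0).
- by move=> y /A_small; rewrite /field => ->; rewrite mulr0.
- by apply: dfield_small; rewrite /q dotv00.
- move=> y y0; have := is_deriveM (P_derive j y) (A_derive j y0) => Hd.
  by apply: (is_derive_eq Hd); rewrite /dfield /GRing.scale /=; ring.
Qed.

Let field_box j y : ~ box d b y -> field j y = 0.
Proof.
move=> yb; rewrite /field /A eta_large ?mul0r ?mulr0// ltNge; apply/negP => qb.
by apply: yb; exact: box_le_dotvv.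
Qed.

Let dfield_box j y : ~ box d b y -> dfield j y = 0.
Proof. by apply: (derive_support_box (@field_derive j)); exact: field_box. Qed.

(** The terms in [eta'] cancel because the row [P] is orthogonal to y; the derivatives of [P] sum to
    -(d - 1) y_i; and [H_radial] removes the part of [P] along y from the terms in [dH]. *)
Let divergence y :
  \sum_j dfield j y = eta (q y) * (q y * dH i y - (d%:R - 1) * (y 0 i * H y)).
Proof.
have [->|y0] := eqVneq y 0.
  rewrite big1 => [|j _]; last first.
    by apply: dfield_small; rewrite /q dotv00.
  by rewrite eta_small ?mul0r// /q dotv00.
have E1 : \sum_j delta j * dH j y = dH i y.
  rewrite (bigD1 i)//= big1 => [|j]; first by rewrite /delta eqxx mul1r addr0.
  by rewrite /delta eq_sym => /negbTE ->; rewrite mul0r.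
have E2 : \sum_j delta j * y 0 j = y 0 i.
  rewrite (bigD1 i)//= big1 => [|j]; first by rewrite /delta eqxx mul1r addr0.
  by rewrite /delta eq_sym => /negbTE ->; rewrite mul0r.
have E3 := H_radial y0.
(* The summand is sorted so that each sum over j is constant, or is |y|^2, or is given by [E1], [E2]
   or [E3]. *)
transitivity (\sum_j (A y * (delta j * y 0 j) - A y * y 0 i
   + 2 * eta' (q y) * H y * q y * (delta j * y 0 j)
   - 2 * eta' (q y) * H y * y 0 i * (y 0 j * y 0 j)
   + eta (q y) * q y * (delta j * dH j y) - eta (q y) * y 0 i *
     (y 0 j * dH j y))).
  by apply: eq_bigr => j _; rewrite /dfield /dP /P /dA; ring.
rewrite !big_split/= !sumrN -!mulr_sumr E1 E2 E3 sumr_const card_ord.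
rewrite -/(dotv y y) -/(q y) /A -mulr_natr. ring.
Qed.

Lemma tangential_field_integral :
  \int[leb]_y (eta (q y) * (q y * dH i y - (d%:R - 1) * (y 0 i * H y))) = 0.
Proof.
under eq_Rintegral do rewrite -divergence.
rewrite /Rintegral.
under eq_integral do rewrite -sumEFin.
have int_dfield j : leb.-integrable setT (EFin \o dfield j).
  have [C _ HC] := support_box_bounded (@dfield_cont j) (@dfield_box j).
  apply: (integrable_support_box _ HC (@dfield_box j)).
  exact: continuous_measurable_fun_rV.
rewrite integral_sum//= big1// => j _.
rewrite -[LHS]fineK; last by apply: integrable_fin_num => //; exact: int_dfield.
congr EFin.
apply: (@integral_derivative_eq0 _ _ (field j) _ (delta_mx 0 j) b).
- by move=> k; rewrite mxE eqxx /=; case: eqP => _; rewrite ?normr1// normr0.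
- exact: field_cont.
- exact: dfield_cont.
- exact: field_derive.
- exact: field_box.
Qed.

End tangential_field.

(** * A C^1 cutoff *)

Section cutoff.
Variable R : realType.
Implicit Types (x h c : R).

(** The truncated square, a C^1 building block for quadratic splines. *)
Definition sqpos x : R := Num.max x 0 ^+ 2.

Lemma is_derive_sqpos x : is_derive x 1 sqpos (2 * Num.max x 0).
Proof.
(* A quadratic bound on the Taylor remainder, uniform in x, avoids a separate limit at the kink. *)
have key h : `|sqpos (h + x) - sqpos x - h * (2 * Num.max x 0)| <= h ^+ 2.
  rewrite ler_norml /sqpos.
  case: (leP x 0) => x0; case: (leP (h + x) 0) => hx0; apply/andP; split; nra.
have H : (fun h : R => h^-1 *: ((sqpos \o shift x) (h *: 1) - sqpos x)) @ 0^' -->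
    2 * Num.max x 0.
  apply/cvgrPdist_le => e e0; near=> h.
  have h0 : h != 0 by near: h; exact: nbhs_dnbhs_neq.
  rewrite /= [h *: 1]mulr1 distrC -[X in _ - X](mulKf h0) -mulrBr normrM normfV.
  rewrite ler_pdivrMl ?normr_gt0//; apply: le_trans (key h) _.
  rewrite -real_normK ?num_real// expr2 ler_wpM2l//.
  by near: h; exact: dnbhs0_le.
by split; [apply/cvg_ex; eexists; exact: H|exact: cvg_lim H].
Unshelve. all: by end_near. Qed.

(** The quadratic spline equal to 0 for x <= 0, 2 x^2 up to 1/2, 1 - 2 (1 - x)^2 up to 1, and 1
    afterwards; its derivative [dstep] is a tent. *)
Definition step x : R := 2 * sqpos x - 4 * sqpos (x - 2^-1) + 2 * sqpos (x - 1).
Definition dstep x : R :=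
  4 * Num.max x 0 - 8 * Num.max (x - 2^-1) 0 + 4 * Num.max (x - 1) 0.

Lemma is_derive_step x : is_derive x 1 step (dstep x).
Proof.
have H u : is_derive x 1 (fun z => sqpos (z - u)) (2 * Num.max (x - u) 0).
  have := @is_derive1_comp _ sqpos (fun z => z - u) x _ 1 (is_derive_sqpos
    (x - u)) _.
  rewrite mulr1; apply.
  by apply: is_derive_eq; rewrite subr0.
have H0 := is_derive_sqpos x; have H1 := H 2^-1; have H2 := H 1.
have Hs := is_deriveD (is_deriveB (is_deriveZ 2 H0) (is_deriveZ 4 H1))
  (is_deriveZ 2 H2).
by apply: (is_derive_eq Hs); rewrite /GRing.scale /= /dstep; ring.
Qed.

Lemma continuous_dstep : continuous dstep.
Proof.
move=> x.
have c0 : {for x, continuous (fun z : R => Num.max z 0)}.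
  by apply: continuous_max; [exact: cvg_id|exact: cst_continuous].
have cm u : {for x, continuous (fun z : R => Num.max (z - u) 0)}.
  apply: continuous_max; last exact: cst_continuous.
  by apply: cvgB; [exact: cvg_id|exact: cvg_cst].
have k4 : {for x, continuous (fun=> 4 : R)} by exact: cst_continuous.
have k8 : {for x, continuous (fun=> 8 : R)} by exact: cst_continuous.
exact: (cvgD (cvgB (cvgM k4 c0) (cvgM k8 (cm 2^-1))) (cvgM k4 (cm 1))).
Qed.

Lemma step_le0 x : x <= 0 -> step x = 0 /\ dstep x = 0.
Proof.
move=> x0; rewrite /step /dstep /sqpos !max_r; [|lra..].
by split; ring.
Qed.

Lemma step_ge1 x : 1 <= x -> step x = 1.
Proof. by move=> x0; rewrite /step /sqpos !max_l; [field|lra..]. Qed.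

Lemma step_itv x : 0 <= step x <= 1.
Proof.
rewrite /step /sqpos.
case: (leP x 0) => x0; case: (leP (x - 2^-1) 0) => x1;
  case: (leP (x - 1) 0) => x2;
  apply/andP; split; nra.
Qed.

(* 0 outside [1/c, 1 + 1/c] and 1 on [2/c, 1]. *)
Definition bump c x : R := step (c * x - 1) * step (c + 1 - c * x).
Definition dbump c x : R :=
  c * (dstep (c * x - 1) * step (c + 1 - c * x) -
       step (c * x - 1) * dstep (c + 1 - c * x)).

Lemma is_derive_bump c x : is_derive x 1 (bump c) (dbump c x).
Proof.
have H1 : is_derive x 1 (fun z : R => c * z - 1) c.
  by apply: is_derive_eq; rewrite /GRing.scale /=; ring.
have H2 : is_derive x 1 (fun z : R => c + 1 - c * z) (- c).
  by apply: is_derive_eq; rewrite /GRing.scale /=; ring.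
have H3 := @is_derive1_comp _ step _ _ _ _ (is_derive_step _) H1.
have H4 := @is_derive1_comp _ step _ _ _ _ (is_derive_step _) H2.
by apply: (is_derive_eq (is_deriveM H3 H4)); rewrite /GRing.scale /= /dbump; ring.
Qed.

Lemma continuous_step : continuous step.
Proof.
by move=> x; have [dx _] := is_derive_step x; apply: differentiable_continuous;
  apply/derivable1_diffP.
Qed.

Lemma continuous_bump c : continuous (bump c).
Proof.
by move=> x; have [dx _] := is_derive_bump c x;
  apply: differentiable_continuous; apply/derivable1_diffP.
Qed.

Lemma continuous_dbump c : continuous (dbump c).
Proof.
move=> x.
have kc : {for x, continuous (fun=> c : R)} by exact: cst_continuous.
have k1 : {for x, continuous (fun=> 1 : R)} by exact: cst_continuous.
have kc1 : {for x, continuous (fun=> c + 1 : R)} by exact: cst_continuous.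
have kid : {for x, continuous (id : R -> R)} by exact: cvg_id.
have a1 : {for x, continuous (fun z : R => c * z - 1)} := cvgB (cvgM kc kid) k1.
have a2 : {for x, continuous (fun z : R => c + 1 - c * z)} := cvgB kc1
  (cvgM kc kid).
have b1 : {for x, continuous (fun z => step (c * z - 1))}.
  by apply: (@continuous_comp _ _ _ (fun z : R => c * z - 1) step);
    [exact: a1|exact: continuous_step].
have b2 : {for x, continuous (fun z => step (c + 1 - c * z))}.
  by apply: (@continuous_comp _ _ _ (fun z : R => c + 1 - c * z) step);
    [exact: a2|exact: continuous_step].
have b3 : {for x, continuous (fun z => dstep (c * z - 1))}.
  by apply: (@continuous_comp _ _ _ (fun z : R => c * z - 1) dstep);
    [exact: a1|exact: continuous_dstep].
have b4 : {for x, continuous (fun z => dstep (c + 1 - c * z))}.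
  by apply: (@continuous_comp _ _ _ (fun z : R => c + 1 - c * z) dstep);
    [exact: a2|exact: continuous_dstep].
exact: (cvgM kc (cvgB (cvgM b3 b2) (cvgM b1 b4))).
Qed.

Lemma bump_itv c x : 0 <= bump c x <= 1.
Proof.
have /andP[s0 s1] := step_itv (c * x - 1).
have /andP[t0 t1] := step_itv (c + 1 - c * x).
by rewrite /bump mulr_ge0//= mulr_ile1.
Qed.

Lemma bump_small c x : 0 < c -> x < c^-1 -> bump c x = 0 /\ dbump c x = 0.
Proof.
move=> c0 xc; have [s0 d0] : step (c * x - 1) = 0 /\ dstep (c * x - 1) = 0.
  by apply: step_le0; rewrite subr_le0 -(mulfV (lt0r_neq0 c0)) ler_pM2l// ltW.
by rewrite /bump /dbump s0 d0 !mul0r subrr mulr0.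
Qed.

(** The support ends at 1 + 1/c <= 2. A bound independent of c is what dominated convergence
    needs. *)
Lemma bump_large c x : 1 <= c -> 2 < x -> bump c x = 0.
Proof.
move=> c1 x2; have [t0 _] : step (c + 1 - c * x) = 0 /\ dstep (c + 1 - c * x) = 0.
  by apply: step_le0; nra.
by rewrite /bump t0 mulr0.
Qed.

Lemma cvg_bump x : 0 < x ->
  bump k.+1%:R x @[k --> \oo] --> (if x <= 1 then 1 else 0 : R).
Proof.
move=> x0; apply/cvgrPdist_le => e e0; near=> k.
have large (z : R) : z <= (Num.truncn z).+1%:R by rewrite ltW// truncnS_gt.
(* This makes the rising factor equal to 1 at x. For x > 1 the next bound, c >= 1/(x - 1), puts x
   beyond the end 1 + 1/c of the support. *)
have c2 : 2 / x <= k.+1%:R.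
  rewrite (le_trans (large _))// ler_nat leqW//; near: k; exact: nbhs_infty_ge.
have cx : (x - 1)^-1 <= k.+1%:R.
  rewrite (le_trans (large _))// ler_nat leqW//; near: k; exact: nbhs_infty_ge.
move: k.+1%:R c2 cx => c; rewrite ler_pdivrMr// => c2 cx.
rewrite /bump step_ge1 ?mul1r; last by lra.
have c0 : 0 < c by rewrite -(pmulr_lgt0 _ x0); lra.
case: (leP x 1) => x1.
  rewrite step_ge1; first by rewrite subrr normr0 ltW.
  by have := ler_wpM2l (ltW c0) x1; lra.
have [-> _] : step (c + 1 - c * x) = 0 /\ dstep (c + 1 - c * x) = 0.
  apply: step_le0; have x10 : 0 < x - 1 by rewrite subr_gt0.
  by have := ler_wpM2l (ltW x10) cx; rewrite mulfV ?gt_eqF//; lra.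
by rewrite subrr normr0 ltW.
Unshelve. all: by end_near. Qed.

End cutoff.

(** * Homogeneous functions *)

Section homogeneous.
Variables (R : realType) (d : nat) (H : 'rV[R]_d -> R).
Local Notation leb := (lebesgue_rV R d).
Hypothesis H_C1 : Ck_on 1 (@punctured R d) H.
Hypothesis H_homog : forall (c : R) y, 0 < c -> H (c *: y) = H y.
Implicit Types (y v : 'rV[R]_d) (i j : 'I_d).

Let dH j := 'D_(delta_mx 0 j) H.

Let H_cont y : y != 0 -> {for y, continuous H}.
Proof. by move=> y0; apply: H_C1.1; rewrite in_punctured. Qed.

Let dH_cont j y : y != 0 -> {for y, continuous (dH j)}.
Proof. by move=> y0; apply: (H_C1.2 j).2.1; rewrite in_punctured. Qed.

Let H_derive j y : y != 0 -> is_derive y (delta_mx 0 j) H (dH j y).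
Proof. by move=> y0; apply: derivableP; apply: (H_C1.2 j).1;
  rewrite in_punctured. Qed.

(** Homogeneity turns a step s at c y into a step s/c at y, and the chain rule gives the factor
    1/c. *)
Lemma derive_homogeneous (c : R) y j : 0 < c -> y != 0 -> dH j (c *: y)
  = c^-1 * dH j y.
Proof.
move=> c0 y0;
  have d0 : is_derive (0 : R) 1 (fun t : R => H (y + t *: delta_mx 0 j)) (dH j y).
  by apply: is_derive_line; rewrite scale0r addr0; exact: H_derive.
have d1 : is_derive (0 : R) 1 (fun s : R => c^-1 * s) c^-1.
  by apply: is_derive_eq; rewrite /GRing.scale /=; ring.
have d0' : is_derive (c^-1 * 0) 1 (fun t : R => H (y + t *: delta_mx 0 j))
  (dH j y).
  by rewrite mulr0.
have : is_derive (c *: y) (delta_mx 0 j) H (c^-1 * dH j y).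
  apply: is_derive_of_line; rewrite mulrC.
  have := @is_derive1_comp _ _ (fun s : R => c^-1 * s) _ _ _ d0' d1.
  rewrite (_ : _ \o _ = fun s : R => H (c *: y + s *: delta_mx 0 j))//.
  apply/funext => s /=; rewrite -(H_homog _ c0) scalerDr scalerA mulrA.
  by rewrite mulfV ?gt_eqF// mul1r.
by case.
Qed.

(** The sum is the derivative of [H] in the direction y, and [H] is constant along the ray through
    y. *)
Lemma euler_homogeneous y : y != 0 -> \sum_j y 0 j * dH j y = 0.
Proof.
move=> y0.
have HD : is_derive y y H (\sum_j y 0 j * dH j y).
  apply: is_derive_partial => j; last exact: dH_cont.
  near=> z; apply: H_derive; rewrite -in_punctured inE; near: z.
  by apply: open_nbhs_nbhs; split; [exact: open_punctured|exact/eqP].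
have H0 : is_derive y y H 0.
  apply: is_derive_of_line.
  apply: (@near_eq_is_derive _ _ _ (cst (H y))).
  near=> s; rewrite /cst -{2}[y]scale1r -scalerDl H_homog//.
  have : `|s| < 1.
    near: s; apply/nbhs_ballP; exists 1 => //= z.
    by rewrite /ball /= sub0r normrN.
  by rewrite ltr_norml => /andP[]; lra.
by case: HD => _ <-; case: H0.
Unshelve. all: by end_near. Qed.

Let k i x := dH i x - (d%:R - 1) * (x 0 i * H x).

Lemma continuous_sphere_density i : {in @punctured R d, continuous (k i)}.
Proof.
move=> y; rewrite in_punctured => y0.
have c1 : {for y, continuous (fun=> d%:R - 1 : R)} by exact: cst_continuous.
have c2 := @continuous_coord R d i y.
have c3 : {for y, continuous (fun z : 'rV[R]_d => z 0 i * H z)} by exact: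
  (cvgM c2 (H_cont y0)).
exact: (cvgB (@dH_cont i y y0) (cvgM c1 c3)).
Qed.

(** The divergence formula becomes a radial cutoff times a function of y/|y|, since [H] has degree 0
    and its partial derivatives have degree -1. *)
Lemma radial_integral i (c : R) : 1 <= c ->
  \int[leb]_y (bump c (dotv y y) * k i (normalize y)) = 0.
Proof.
move=> c1; have c0 : 0 < c by lra.
(* The factor 1/r compensates for q d_i H - (d-1) y_i H = r k(y/|y|). *)
pose eta x := bump c x / Num.sqrt x.
pose eta' x := dbump c x / Num.sqrt x - bump c x * (2 * Num.sqrt x)^-1 /
  (Num.sqrt x * Num.sqrt x).
have eta_derive (x : R) : 0 < x -> is_derive x 1 eta (eta' x).
  move=> x0; have r0 : Num.sqrt x != 0 by rewrite gt_eqF ?sqrtr_gt0.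
  have Hr := is_derive1_sqrt x0.
  have := is_deriveM (is_derive_bump c x) (is_deriveV r0 Hr) => Hd.
  apply: (is_derive_eq Hd); rewrite /GRing.scale /= /eta'. field.
  by rewrite r0.
have eta'_cont (x : R) : 0 < x -> {for x, continuous eta'}.
  move=> x0; have r0 : Num.sqrt x != 0 by rewrite gt_eqF ?sqrtr_gt0.
  have cr : {for x, continuous (Num.sqrt : R -> R)} by exact: sqrt_continuous.
  have k2 : {for x, continuous (fun=> 2 : R)} by exact: cst_continuous.
  have a1 : {for x, continuous (fun z => dbump c z / Num.sqrt z)}.
    exact: (cvgM (@continuous_dbump R c x) (cvgV r0 cr)).
  have r20 : 2 * Num.sqrt x != 0 by rewrite mulf_neq0.
  have a2 : {for x, continuous (fun z => bump c z * (2 * Num.sqrt z)^-1)}.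
    exact: (cvgM (@continuous_bump R c x) (cvgV r20 (cvgM k2 cr))).
  have rr0 : Num.sqrt x * Num.sqrt x != 0 by rewrite mulf_neq0.
  have a3 : {for x, continuous (fun z : R => (Num.sqrt z * Num.sqrt z)^-1)}.
    exact: (cvgV rr0 (cvgM cr cr)).
  exact: (cvgB a1 (cvgM a2 a3)).
have eta_small (x : R) : x < c^-1 -> eta x = 0.
  by move=> xc; rewrite /eta (bump_small c0 xc).1 mul0r.
have eta'_small (x : R) : x < c^-1 -> eta' x = 0.
  by move=> xc;
    rewrite /eta' (bump_small c0 xc).1 (bump_small c0 xc).2 !mul0r subrr.
have eta_large (x : R) : 2 ^+ 2 < x -> eta x = 0.
  by move=> x4; rewrite /eta bump_large ?mul0r//; lra.
have ci0 : 0 < c^-1 by rewrite invr_gt0.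
(* The bump vanishes below 1/c and above 2, a fortiori above 2^2, so b = 2 works for every c. *)
have := @tangential_field_integral R d eta eta' c^-1 2 ci0
  (ler0n _ 2) eta_derive eta'_cont
  eta_small eta'_small eta_large H dH H_cont dH_cont H_derive euler_homogeneous i.
move=> <-; apply: eq_Rintegral => y _.
have [->|y0] := eqVneq y 0.
  by rewrite dotv00 (bump_small c0 _).1// eta_small ?dotv00// !mul0r.
have r0 := enorm_gt0 y0.
have rV0 : 0 < (enorm y)^-1 by rewrite invr_gt0.
rewrite /k /normalize derive_homogeneous// H_homog// invrK mxE /eta.
rewrite -/(enorm y); set B := bump _ _.
have -> : dotv y y = enorm y ^+ 2 by rewrite sqr_sqrtr ?dotvv_ge0.
by field; rewrite gt_eqF.
Qed.

(** The bumps with c = n + 1 converge to the indicator of the punctured ball, and the limit of the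
    integrals in [radial_integral] is the one in [sphere_integralE]. *)
Lemma sphere_integral_homogeneous i : sphere_integral (k i) = 0.
Proof.
rewrite (sphere_integralE (@continuous_sphere_density i)).
apply/eqP; rewrite mulf_eq0; apply/orP; right; apply/eqP.
have [C C0 HC] := sphere_fun_bounded (@continuous_sphere_density i).
(* [k] is controlled only away from 0, while [normalize 0 = 0]; the restriction is bounded
   everywhere, and [bump0] makes the value at 0 irrelevant. *)
pose k0 := k i \_ (@sphere R d).
have mk0 : measurable_fun setT (k0 \o @normalize R d).
  apply: (measurableT_comp _ (@measurable_normalize R d)).
  apply/(measurable_restrictT _ (@measurable_sphere R d)).
  by apply: measurable_sphere_fun; exact: continuous_sphere_density.
have k0E y : y != 0 -> k0 (normalize y) = k i (normalize y).
  by move=> y0; rewrite /k0 patchE mem_set//; exact: enorm_normalize.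
have k0C y : `|k0 (normalize y)| <= C.
  by rewrite /k0 patchE; case: ifPn => [|_]; rewrite ?normr0// inE; exact: HC.
have bump0 n : bump n.+1%:R (dotv (0 : 'rV[R]_d) 0) = 0.
  by rewrite dotv00; apply: (bump_small _ _).1; rewrite ?invr_gt0 ltr0n.
pose f n y : R := bump n.+1%:R (dotv y y) * k0 (normalize y).
pose g y : R := \1_(@punctured_ball R d) y * k0 (normalize y).
have mf n : measurable_fun setT (f n).
  apply: measurable_funM => //; apply: continuous_measurable_fun_rV => y.
  apply: (@continuous_comp _ _ _ (fun z : 'rV[R]_d => dotv z z) (bump n.+1%:R)).
    exact: continuous_dotvv.
  exact: continuous_bump.
have mg : measurable_fun setT g.
  by apply: measurable_funM => //; apply: measurable_indic;
    exact: measurable_punctured_ball.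
have fE n : \int[leb]_y f n y = 0.
  rewrite -(@radial_integral i n.+1%:R) ?ler1n//; apply: eq_Rintegral => y _.
  rewrite /f; have [->|y0] := eqVneq y 0; first by rewrite bump0 !mul0r.
  by rewrite k0E.
have fC n y : `|f n y| <= C * \1_(box d 2) y.
  rewrite /f indicE; case: (boolP (y \in box d 2)) => yb /=.
    rewrite mulr1 normrM; have /andP[b0 b1] := @bump_itv R n.+1%:R (dotv y y).
    by rewrite -[leRHS]mul1r ler_pM// ger0_norm.
  rewrite bump_large ?mul0r ?normr0 ?mulr0 ?ler1n// ltNge.
  apply: contra yb => yq; rewrite inE; apply: box_le_dotvv => //.
  by rewrite (le_trans yq)//; lra.
have iC : leb.-integrable setT (EFin \o (fun y => C * \1_(box d 2) y)).
  apply: (@integrable_support_box _ _ _ 2 C).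
  + by apply: measurable_funM => //; apply: measurable_indic;
    exact: measurable_box.
  + by move=> y; rewrite indicE; case: (y \in _);
    rewrite ?mulr0 ?mulr1 ?normr0// ger0_norm.
  + by move=> y yb; rewrite indicE memNset// mulr0.
have [] := @dominated_convergence _ _ _ leb setT measurableT
  (fun n y => (f n y)%:E) (fun y => (g y)%:E) (fun y => (C * \1_(box d 2) y)%:E).
- by move=> n; exact/measurable_EFinP.
- exact/measurable_EFinP.
- apply: aeW => y _; apply/cvg_EFin; first by near=> n.
  rewrite (_ : fine \o _ = fun n => f n y)//; apply: cvgM; last exact: cvg_cst.
  have [->|y0] := eqVneq y 0.
    rewrite indicE memNset; last by case/punctured_ballP; rewrite eqxx.
    by under eq_cvg do rewrite bump0; exact: cvg_cst.
  have := cvg_bump (dotvv_gt0 y0); rewrite indicE.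
  rewrite (_ : y \in @punctured_ball R d = (dotv y y <= 1)).
    by case: leP.
  apply/idP/idP => [|yq]; first by rewrite inE => /punctured_ballP[].
  by rewrite inE; apply/punctured_ballP.
- exact: iC.
- by apply: aeW => y n _; rewrite lee_fin.
move=> ig _ Hc.
transitivity (\int[leb]_y g y).
  rewrite Rintegral_mkcond; apply: eq_Rintegral => y _.
  rewrite /g patchE indicE; case: (boolP (y \in @punctured_ball R d)) => /= yb.
    by move: yb; rewrite mul1r inE => /punctured_ballP[y0 _]; rewrite k0E.
  by rewrite mul0r.
(* [fE] concerns real integrals, where [fine] also sends infinite values to 0; integrability
   recovers the extended equality. *)
have fE' n : (\int[leb]_y (f n y)%:E = 0)%E.
  rewrite -[LHS]fineK; first by congr EFin; exact: fE.
  apply: integrable_fin_num => //; apply: (le_integrable _ _ _ iC) => //.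
    exact/measurable_EFinP.
  by move=> y _ /=; rewrite lee_fin (le_trans (fC n y))// ler_norm.
rewrite /Rintegral.
have E : (fun n => \int[leb]_y (f n y)%:E)%E = cst 0%E by apply/funext.
by rewrite E in Hc; rewrite -(cvg_unique _ (@cvg_cst _ _ _ _ _) Hc).
Unshelve. all: by end_near. Qed.

End homogeneous.

(** * Integration by parts on the sphere *)

Section integration_by_parts.
Variables (R : realType) (d : nat).
Implicit Types (x y : 'rV[R]_d) (i j : 'I_d) (f g F G k : 'rV[R]_d -> R).
Local Notation U := (@punctured R d).

Lemma Ck_on_cont n F y : Ck_on n U F -> y != 0 -> {for y, continuous F}.
Proof. by case: n => [|n] [cF _] y0; apply: cF; rewrite in_punctured. Qed.

Lemma Ck_on_derive n F i y : Ck_on n.+1 U F -> y != 0 ->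
  is_derive y (delta_mx 0 i) F ('D_(delta_mx 0 i) F y).
Proof. by move=> [_ /(_ i)[dF _]] y0; apply: derivableP; apply: dF;
  rewrite in_punctured. Qed.

Lemma Ck_on_partial n F i : Ck_on n.+1 U F -> Ck_on n U ('D_(delta_mx 0 i) F).
Proof. by move=> [_ /(_ i)[]]. Qed.

Lemma Ck_on_le n F : Ck_on n.+1 U F -> Ck_on n U F.
Proof.
elim: n F => [|n IH] F CF; first by split=> //; case: CF.
split; first by case: CF.
by move=> i; case: CF => _ /(_ i)[dF CF]; split=> //; exact: IH.
Qed.

Lemma near_punctured y : y != 0 -> \forall z \near y, z != 0.
Proof.
move=> y0; near=> z; rewrite -in_punctured inE; near: z.
by apply: open_nbhs_nbhs; split; [exact: open_punctured|exact/eqP].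
Unshelve. all: by end_near. Qed.

(** [dF] agrees with the partial derivatives only off the origin, so continuity is transferred
    through agreement near each point of the open punctured space. *)
Lemma Ck_on_intro F (dF : 'I_d -> 'rV[R]_d -> R) :
  (forall y, y != 0 -> {for y, continuous F}) ->
  (forall j y, y != 0 -> is_derive y (delta_mx 0 j) F (dF j y)) ->
  (forall j y, y != 0 -> {for y, continuous (dF j)}) -> Ck_on 1 U F.
Proof.
move=> cF HF cdF; split=> [y|j]; rewrite ?in_punctured; first exact: cF.
split=> [y|]; first by rewrite in_punctured => /(HF j)[].
split=> // y; rewrite in_punctured => y0.
have E z : z != 0 -> 'D_(delta_mx 0 j) F z = dF j z by move=> /(HF j)[].
have : 'D_(delta_mx 0 j) F @ nbhs y --> 'D_(delta_mx 0 j) F y; last exact.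
rewrite (E y y0).
apply: cvg_trans (cdF j y y0); apply: near_eq_cvg.
near=> z; apply/esym/E; near: z; exact: near_punctured.
Unshelve. all: by end_near. Qed.

Lemma extend0_homog f (c : R) y : 0 < c -> extend0 f (c *: y) = extend0 f y.
Proof. by move=> c0; rewrite /extend0 normalizeZ. Qed.

Lemma extend0_sphere f x : sphere x -> extend0 f x = f x.
Proof. by move=> x1; rewrite /extend0 normalize_sphere. Qed.

Lemma eq_sphere_integral k1 k2 : (forall x, sphere x -> k1 x = k2 x) ->
  sphere_integral k1 = sphere_integral k2.
Proof. by move=> E; apply: eq_Rintegral => x; rewrite inE; exact: E. Qed.

Lemma sphere_integralD k1 k2 :
  {in U, continuous k1} -> {in U, continuous k2} ->
  sphere_integral (fun x => k1 x + k2 x)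
    = sphere_integral k1 + sphere_integral k2.
Proof.
move=> c1 c2; apply: RintegralD; first exact: measurable_sphere.
  exact: sphere_integrable.
exact: sphere_integrable.
Qed.

Lemma sphere_integral_sum (I : Type) (s : seq I) (k : I -> 'rV[R]_d -> R) :
  (forall a, {in U, continuous (k a)}) ->
  sphere_integral (fun x => \sum_(a <- s) k a x)
    = \sum_(a <- s) sphere_integral (k a).
Proof.
move=> ck; elim: s => [|a s IH].
  rewrite big_nil (@eq_sphere_integral _ (cst 0)) => [|x _];
    last by rewrite big_nil.
  by rewrite /sphere_integral Rintegral_cst ?mul0r//; exact: measurable_sphere.
rewrite big_cons -IH -sphere_integralD//.
  by apply: eq_sphere_integral => x _; rewrite big_cons.
by move=> y yU; apply: continuous_at_sum => b; exact: ck.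
Qed.

Lemma sphere_gradient_by_parts f g i :
  Ck_sphere 1 f -> Ck_sphere 1 g ->
  sphere_integral (fun x => f x * 'D_(delta_mx 0 i) (extend0 g) x) =
  - sphere_integral (fun x => g x *
     ('D_(delta_mx 0 i) (extend0 f) x - (d%:R - 1) * f x * x 0 i)).
Proof.
rewrite /Ck_sphere; set F := extend0 f; set G := extend0 g => CF CG.
pose H y := F y * G y.
pose dH j y := F y * 'D_(delta_mx 0 j) G y + G y * 'D_(delta_mx 0 j) F y.
have cF y : y != 0 -> {for y, continuous F} by exact: Ck_on_cont CF.
have cG y : y != 0 -> {for y, continuous G} by exact: Ck_on_cont CG.
have cdF j y : y != 0 -> {for y, continuous ('D_(delta_mx 0 j) F)}.
  exact: Ck_on_cont (Ck_on_partial j CF).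
have cdG j y : y != 0 -> {for y, continuous ('D_(delta_mx 0 j) G)}.
  exact: Ck_on_cont (Ck_on_partial j CG).
have cFdG j y : y != 0 -> {for y, continuous (fun z
  => F z * 'D_(delta_mx 0 j) G z)}.
  by move=> y0; exact: (cvgM (cF y y0) (cdG j y y0)).
have cGdF j y : y != 0 -> {for y, continuous (fun z
  => G z * 'D_(delta_mx 0 j) F z)}.
  by move=> y0; exact: (cvgM (cG y y0) (cdF j y y0)).
have dHE j y : y != 0 -> is_derive y (delta_mx 0 j) H (dH j y).
  move=> y0; exact: (is_deriveM (Ck_on_derive j CF y0) (Ck_on_derive j CG y0)).
have cH y : y != 0 -> {for y, continuous H}.
  by move=> y0; exact: (cvgM (cF y y0) (cG y y0)).
have CH : Ck_on 1 U H.
  by apply: (Ck_on_intro cH dHE) => j y y0;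
    exact: (cvgD (cFdG j y y0) (cGdF j y y0)).
have H_homog (c : R) y : 0 < c -> H (c *: y) = H y.
  by move=> c0; rewrite /H /F /G !extend0_homog.
(* By the product rule, [a] + [b] is the density attached to [H] = [F] [G], whose integral is
   zero. *)
pose a x := F x * 'D_(delta_mx 0 i) G x.
pose b x := G x * 'D_(delta_mx 0 i) F x - (d%:R - 1) * (x 0 i * H x).
have ca : {in U, continuous a} by move=> y; rewrite in_punctured; exact: cFdG.
have cb : {in U, continuous b}.
  move=> y; rewrite in_punctured => y0.
  have c1 : {for y, continuous (fun=> d%:R - 1 : R)} by exact: cst_continuous.
  have c2 := @continuous_coord R d i y.
  have c3 : {for y, continuous (fun z : 'rV[R]_d => z 0 i * H z)} by exact:
    (cvgM c2 (cH y y0)).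
  exact: (cvgB (cGdF i y y0) (cvgM c1 c3)).
apply/eqP; rewrite -addr_eq0; apply/eqP.
rewrite (@eq_sphere_integral _ a) => [|x x1];
  last by rewrite /a /F extend0_sphere.
rewrite [X in _ + X](@eq_sphere_integral _ b) => [|x x1]; last first.
  by rewrite /b /H /F /G !extend0_sphere//; ring.
rewrite -sphere_integralD// -(sphere_integral_homogeneous CH H_homog i).
apply: eq_sphere_integral => x /sphere_neq0 x0.
by case: (dHE i x x0) => _ ->; rewrite /a /b /dH addrA.
Qed.

Lemma sphere_green f g : Ck_sphere 2 f -> Ck_sphere 1 g ->
  sphere_integral (fun x => dotv (sgrad f x) (sgrad g x)) =
  - sphere_integral (fun x => slaplacian f x * g x).
Proof.
rewrite /Ck_sphere /sgrad /slaplacian; set F := extend0 f;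
  set G := extend0 g => CF CG.
pose e j : 'rV[R]_d := delta_mx 0 j.
have CF1 := Ck_on_le CF.
have F_homog (c : R) y : 0 < c -> F (c *: y) = F y by exact: extend0_homog.
pose D i := 'D_(e i) F.
have CD i : Ck_on 1 U (D i) by exact: (Ck_on_partial i CF).
have cD i y : y != 0 -> {for y, continuous (D i)} by exact: Ck_on_cont (CD i).
have cG y : y != 0 -> {for y, continuous G} by exact: Ck_on_cont CG.
have cdD i j y : y != 0 -> {for y, continuous ('D_(e j) (D i))}.
  exact: Ck_on_cont (Ck_on_partial j (CD i)).
have cdG j y : y != 0 -> {for y, continuous ('D_(e j) G)}.
  exact: Ck_on_cont (Ck_on_partial j CG).
pose DG i y := D i y * G y.
pose dDG i j y := D i y * 'D_(e j) G y + G y * 'D_(e j) (D i) y.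
have cDG i y : y != 0 -> {for y, continuous (DG i)}.
  by move=> y0; exact: (cvgM (cD i y y0) (cG y y0)).
have cDdG i j y : y != 0 -> {for y, continuous (fun z => D i z * 'D_(e j) G z)}.
  by move=> y0; exact: (cvgM (cD i y y0) (cdG j y y0)).
have cGdD i j y : y != 0 -> {for y, continuous (fun z => G z * 'D_(e j) (D i) z)}.
  by move=> y0; exact: (cvgM (cG y y0) (cdD i j y y0)).
have cdDG i j y : y != 0 -> {for y, continuous (dDG i j)}.
  by move=> y0; exact: (cvgD (cDdG i j y y0) (cGdD i j y y0)).
have dDGE i j y : y != 0 -> is_derive y (e j) (DG i) (dDG i j y).
  move=> y0; exact: (is_deriveM (Ck_on_derive j (CD i) y0)
    (Ck_on_derive j CG y0)).
(* A first derivative of [F] has degree -1; the factor |y| restores degree 0 and equals 1 on the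
   sphere. *)
pose H i y := enorm y * DG i y.
pose dH i j y := enorm y * dDG i j y + DG i y * ((enorm y)^-1 * y 0 j).
have dHE i j y : y != 0 -> is_derive y (e j) (H i) (dH i j y).
  move=> y0; have H1 := @is_derive_comp_real R _ Num.sqrt (fun z
    => dotv z z) y _ _ _
    (is_derive1_sqrt (dotvv_gt0 y0)) (is_derive_dotvv y (e j)).
  have H2 := is_deriveM H1 (dDGE i j y y0).
  apply: (is_derive_eq H2); rewrite dotv_delta /GRing.scale /= -/(enorm y) /dH.
  by field; rewrite gt_eqF ?enorm_gt0.
have cH i y : y != 0 -> {for y, continuous (H i)}.
  by move=> y0; exact: (cvgM (@continuous_enorm R d y) (cDG i y y0)).
have cdH i j y : y != 0 -> {for y, continuous (dH i j)}.
  move=> y0; have r0 : enorm y != 0 by rewrite gt_eqF ?enorm_gt0.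
  have c1 : {for y, continuous (fun z => enorm z * dDG i j z)}.
    exact: (cvgM (@continuous_enorm R d y) (cdDG i j y y0)).
  have c2 : {for y, continuous (fun z : 'rV[R]_d => (enorm z)^-1 * z 0 j)}.
    exact: (cvgM (cvgV r0 (@continuous_enorm R d y)) (@continuous_coord R d j y)).
  exact: (cvgD c1 (cvgM (cDG i y y0) c2)).
have CH i : Ck_on 1 U (H i) := Ck_on_intro (cH i) (dHE i) (cdH i).
have H_homog i (c : R) y : 0 < c -> H i (c *: y) = H i y.
  move=> c0; have [->|y0] := eqVneq y 0; first by rewrite scaler0.
  rewrite /H /DG enormZ ?ltW// /D
    (derive_homogeneous CF1 F_homog)// /G extend0_homog//.
  by field; rewrite gt_eqF.
pose k i x := 'D_(e i) (H i) x - (d%:R - 1) * (x 0 i * H i x).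
have ck i : {in U, continuous (k i)} by exact:
  (@continuous_sphere_density _ _ _ (CH i)).
have Sk : sphere_integral (fun x => \sum_i k i x) = 0.
  rewrite sphere_integral_sum// big1// => i _.
  exact: (sphere_integral_homogeneous (CH i) (H_homog i)).
pose a x := \sum_i D i x * 'D_(e i) G x.
pose b x := \sum_i G x * 'D_(e i) (D i) x.
have ca : {in U, continuous a}.
  by move=> y; rewrite in_punctured => y0; apply: continuous_at_sum => i;
    exact: cDdG.
have cb : {in U, continuous b}.
  by move=> y; rewrite in_punctured => y0; apply: continuous_at_sum => i;
    exact: cGdD.
apply/eqP; rewrite -addr_eq0; apply/eqP.
rewrite (@eq_sphere_integral _ a) => [|x _]; last first.
  by apply: eq_bigr => i _; rewrite !mxE.
rewrite [X in _ + X](@eq_sphere_integral _ b) => [|x x1]; last first.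
  by rewrite /laplacian -(extend0_sphere g x1) mulr_suml;
    apply: eq_bigr => i _; rewrite mulrC.
rewrite -sphere_integralD// -Sk.
apply: eq_sphere_integral => x x1; have x0 := sphere_neq0 x1.
have E : \sum_i x 0 i * D i x = 0 := euler_homogeneous CF1 F_homog x0.
(* The coefficient 2 - d is 1, from the derivative x_i of |y| on the sphere, minus the d - 1 of the
   density; it multiplies Euler's sum [E]. *)
transitivity (\sum_i (D i x * 'D_(e i) G x + G x * 'D_(e i) (D i) x
   + (2 - d%:R) * G x * (x 0 i * D i x))).
  by rewrite !big_split/= -[X in _ = _ + X]mulr_sumr E mulr0 addr0.
apply: eq_bigr => i _; rewrite /k; case: (dHE i i x x0) => _ ->.
by rewrite /dH /dDG /H /DG x1; field.
Qed.

End integration_by_parts.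

Theorem proposition8p7 (R : realType) (d : nat) (hd : (2 <= d)%N) :
  (forall f g : 'rV[R]_d -> R,
    Ck_sphere 1 f -> Ck_sphere 1 g ->
    sphere_vintegral (fun x => f x *: sgrad g x) =
    - sphere_vintegral
        (fun x => g x *: (sgrad f x - ((d%:R - 1) * f x) *: x))) /\
  (forall f g : 'rV[R]_d -> R,
    Ck_sphere 2 f -> Ck_sphere 1 g ->
    sphere_integral (fun x => dotv (sgrad f x) (sgrad g x)) =
    - sphere_integral (fun x => slaplacian f x * g x)).
Proof.
split=> f g Cf Cg; last exact: sphere_green.
apply/rowP => i; rewrite !mxE.
transitivity (sphere_integral (fun x => f x * 'D_(delta_mx 0 i) (extend0 g) x)).
  by apply: eq_sphere_integral => x _; rewrite !mxE.
rewrite (sphere_gradient_by_parts i Cf Cg); congr (- _).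
by apply: eq_sphere_integral => x _; rewrite !mxE.
Qed.
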